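(* Let $\mu$ be a regular measure on the closed unit disk $\overline{\mathbb{D}}=\{z:|z|\le1\}$. Then there is a subsequence $\mathcal{N}\subseteq\mathbb{N}$ of asymptotic density $1$ such that the probability measures $|p_n(z;\mu)|^2\,d\mu(z)$ converge weakly, as $n\to\infty$ through $\mathcal{N}$, to the normalized arc-length measure $\frac{d\theta}{2\pi}$ on the unit circle $\partial\mathbb{D}$.
   Context: All measures are positive, finite, compactly supported Borel measures on $\mathbb{C}$ with infinite support. $p_n(z;\mu)=\kappa_n z^n+\cdots$, $\kappa_n>0$, is the degree-$n$ orthonormal polynomial of $\mu$: $\int \overline{p_n}\,p_m\,d\mu=\delta_{nm}$. The measure $\mu$ is called regular if $\lim_{n\to\infty}\kappa_n^{-1/n}=\mathrm{capacity}(\mathrm{supp}(\mu))$ (logarithmic capacity). $\mu$ is regular on $\overline{\mathbb{D}}$ if $\mu$ is regular, $\mathrm{supp}(\mu)\subseteq\overline{\mathbb{D}}$, and $\partial\mathbb{D}\subseteq\mathrm{supp}(\mu)$. A set $\mathcal{N}\subseteq\mathbb{N}$ has asymptotic density $1$ if $\lim_{n\to\infty}\#(\mathcal{N}\cap\{1,\dots,n\})/n=1$. Weak convergence means convergence of integrals against every continuous function on $\overline{\mathbb{D}}$. *)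

(* Defs.v *)
From HB Require Import structures.
From mathcomp Require Import all_boot all_order all_algebra.
From mathcomp Require Import all_classical all_reals all_analysis.
From mathcomp Require Import measurable_realfun complex.

Set Implicit Arguments.
Unset Strict Implicit.
Unset Printing Implicit Defensive.

Import Order.TTheory GRing.Theory Num.Theory.
Import numFieldNormedType.Exports.
Import ComplexField.Normc.

Local Open Scope classical_set_scope.
Local Open Scope ring_scope.
Local Open Scope complex_scope.

(* The norm of [R[i]] takes values in [R[i]] and [normc] in [R]; the balls
   [ball_ (fun x => `|x|)] of [R[i]^o] are the Euclidean disks. *)
HB.instance Definition _ (R : realType) := NormedModule.copy R[i] R[i]^o.
HB.instance Definition _ (R : realType) :=
  Measurable.copy R[i] (g_sigma_algebraType (@open R[i])).

Section measurability.
Context {R : realType}.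
Implicit Types (z : R[i]) (p : {poly R[i]}).

Lemma continuous_normc : continuous (@normc R : R[i] -> R).
Proof.
move=> z; apply/(@cvgrPdist_lt _ _ _ (nbhs z)) => e e0.
have nz : nbhs z [set w | `|z - w| < e%:C] by exists e%:C; rewrite //= ltcR.
apply: filterS nz => w /=.
rewrite (_ : `|z - w| = (normc (z - w))%:C) // ltcR => zw; apply: le_lt_trans zw.
have H (a b : R[i]) : normc a - normc b <= normc (a - b).
  by rewrite lerBlDr -{1}(subrK b a); exact: le_normcD.
by rewrite ler_norml H andbT lerNl opprB -(normcN (z - w)) opprB H.
Qed.

Lemma continuous_hornerC p : continuous (horner p : R[i] -> R[i]).
Proof.
elim/poly_ind: p => [|p c IHp].
  rewrite (_ : horner 0 = cst 0); first exact: cst_continuous.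
  by apply/funext => x; rewrite horner0.
rewrite (_ : horner _ = fun x => p.[x] * x + c); last first.
  by apply/funext => x; rewrite hornerMXaddC.
move=> z; have IHpz : p.[x] @[x --> z] --> p.[z] := IHp z.
have idz : x @[x --> z] --> z by exact: cvg_id.
have cz : (cst c : R[i] -> R[i]) x @[x --> z] --> c := @cst_continuous _ _ c z.
exact: (cvgD (cvgM IHpz idz) cz).
Qed.

Lemma continuous_measurable_funC (f : R[i] -> R) :
  continuous f -> measurable_fun setT f.
Proof.
move=> /continuousP cf.
apply: (measurability _ (RGenOpens.measurableE R)) => _ [_ [a [b ->]] <-].
rewrite setTI; apply: sub_sigma_algebra; apply: cf; exact: interval_open.
Qed.

Lemma measurable_sqnorm_poly p :
  measurable_fun setT (fun z => (normc p.[z] ^+ 2)%:E).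
Proof.
apply: (measurableT_comp (@EFin_measurable R setT)).
apply: continuous_measurable_funC => z.
have npz : normc p.[w] @[w --> z] --> normc p.[z].
  exact: (continuous_comp (@continuous_hornerC p z) (@continuous_normc _)).
exact: (cvgM npz npz).
Qed.

Definition expi (t : R) : R[i] := cos t +i* sin t.

Lemma measurable_expi : measurable_fun setT expi.
Proof.
apply: (@measurability _ _ _ _ setT expi (@open R[i])) => //.
move=> _ [U oU <-]; rewrite setTI; apply: open_measurable.
apply: open_comp => // t _.
apply/(@cvgrPdist_lt R[i] R[i]^o) => e.
case: e => e e' /[dup]; rewrite {1}ltcE/= => /andP[/eqP-> e0 _].
have e20 : 0 < e / 2 by rewrite divr_gt0.
near=> u; rewrite normc_def ltcR /=.
have hc : `|cos t - cos u| < e / 2.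
  by near: u; move: (@continuous_cos R t) => /cvgrPdist_lt; exact.
have hs : `|sin t - sin u| < e / 2.
  by near: u; move: (@continuous_sin R t) => /cvgrPdist_lt; exact.
rewrite -[ltRHS]ger0_norm ?ltW// -sqrtr_sqr ltr_sqrt ?exprn_gt0//.
rewrite -(real_normK (num_real (cos t - _))) -(real_normK (num_real (sin t - _))).
rewrite (@lt_le_trans _ _ ((e / 2) ^+ 2 + (e / 2) ^+ 2))//.
  by rewrite ltrD// ltrXn2r// ?nnegrE ?ltW.
rewrite [in leRHS](splitr e) sqrrD lerD2r lerDl mulrn_wge0//.
by rewrite mulr_ge0// ltW.
Unshelve. all: by end_near. Qed.

End measurability.

Section definitions.
Context {R : realType}.
Implicit Types (mu : {finite_measure set R[i] -> \bar R}) (K : set R[i]).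

Definition closed_unit_disk : set R[i] := [set z | `|z| <= 1].
Definition unit_circle : set R[i] := [set z | `|z| = 1].

Definition support (mu : set R[i] -> \bar R) : set R[i] :=
  [set z | forall U, open U -> U z -> (0 < mu U)%E].

Definition Cintegral (mu : {measure set R[i] -> \bar R}) (D : set R[i])
    (f : R[i] -> R[i]) : R[i] :=
  (\int[mu]_(z in D) complex.Re (f z)) +i* (\int[mu]_(z in D) complex.Im (f z)).

(* [lne 0 = -oo], so the kernel log (1 / |z - w|) is [+oo] on the diagonal. *)
Definition log_energy (nu : {measure set R[i] -> \bar R}) : \bar R :=
  (\int[nu]_z \int[nu]_w (- lne (normc (z - w))%:E))%E.

(* [ereal_inf set0 = +oo], so sets carrying no probability of finite energy
   have capacity 0. *)
Definition capacity K : \bar R :=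
  expeR (- ereal_inf [set log_energy nu | nu in
           [set nu : probability R[i] R | nu K = 1%E]])%E.

(* In the order of [R[i]], [0 < c] says that [c] is real and positive. *)
Definition orthonormal_polys mu (p : nat -> {poly R[i]}) : Prop :=
  (forall n, size (p n) = n.+1 /\ 0 < lead_coef (p n)) /\
  (forall n m, Cintegral mu setT (fun z => ((p n).[z])^*%C * (p m).[z]) =
               (n == m)%:R).

(* If [support mu] is compact and infinite, exactly one sequence satisfies
   [orthonormal_polys mu]; [fun=> 0] is never selected then. *)
Definition orthonormal_poly mu : nat -> {poly R[i]} :=
  xget (fun=> 0) (orthonormal_polys mu).

Definition kappa mu (n : nat) : R := complex.Re (lead_coef (orthonormal_poly mu n)).

Definition admissible mu : Prop :=
  compact (support mu) /\ infinite_set (support mu).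

Definition regular mu : Prop :=
  (kappa mu n `^ (- n%:R^-1))%:E @[n --> \oo] --> capacity (support mu).

Definition regular_on_closed_disk mu : Prop :=
  [/\ regular mu, support mu `<=` closed_unit_disk &
      unit_circle `<=` support mu].

Definition sqnorm_measure mu (p : {poly R[i]}) (A : set R[i]) : \bar R :=
  \int[mu]_(z in A) (normc p.[z] ^+ 2)%:E.

Section sqnorm_measure.
Context (mu : {finite_measure set R[i] -> \bar R}) (p : {poly R[i]}).

Let sqnorm_measure0 : sqnorm_measure mu p set0 = 0%E.
Proof. by rewrite /sqnorm_measure integral_set0. Qed.

Let sqnorm_measure_ge0 A : (0 <= sqnorm_measure mu p A)%E.
Proof. by apply: integral_ge0 => z _; rewrite lee_fin sqr_ge0. Qed.

Let sqnorm_measure_sigma_additive : semi_sigma_additive (sqnorm_measure mu p).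
Proof.
apply: semi_sigma_additive_nng_induced; first exact: measurable_sqnorm_poly.
by move=> z; rewrite lee_fin sqr_ge0.
Qed.

HB.instance Definition _ := isMeasure.Build _ _ _ (sqnorm_measure mu p)
  sqnorm_measure0 sqnorm_measure_ge0 sqnorm_measure_sigma_additive.

End sqnorm_measure.

Lemma pi2_gt0 : 0 < 2 * pi :> R.
Proof. by rewrite mulr_gt0 ?pi_gt0. Qed.

Definition arclength : set R[i] -> \bar R :=
  pushforward (uniform_prob pi2_gt0) expi.

Let arclength0 : arclength set0 = 0%E.
Proof. by rewrite /arclength /pushforward preimage_set0 measure0. Qed.

Let arclength_ge0 A : (0 <= arclength A)%E.
Proof. exact: (measure_ge0 (uniform_prob pi2_gt0)). Qed.

Let arclength_sigma_additive : semi_sigma_additive arclength.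
Proof.
move=> F mF tF mUF; rewrite /arclength /pushforward preimage_bigcup.
apply: measure_semi_sigma_additive.
- by move=> n; rewrite -[X in measurable X]setTI; exact: measurable_expi.
- apply/trivIsetP => /= i j _ _ ij; rewrite -preimage_setI.
  by move/trivIsetP : tF => /(_ _ _ _ _ ij) ->//; rewrite preimage_set0.
- by rewrite -preimage_bigcup -[X in measurable X]setTI; exact: measurable_expi.
Qed.

HB.instance Definition _ := isMeasure.Build _ _ _ arclength
  arclength0 arclength_ge0 arclength_sigma_additive.

Let arclength_setT : arclength setT = 1%E.
Proof. by rewrite /arclength /pushforward preimage_setT probability_setT. Qed.

HB.instance Definition _ :=
  Measure_isProbability.Build _ _ _ arclength arclength_setT.

Definition weak_cvg (D : set R[i]) (F : set_system nat)
    (nu_ : nat -> {measure set R[i] -> \bar R})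
    (nu : {measure set R[i] -> \bar R}) : Prop :=
  forall f : R[i] -> R[i], {within D, continuous f} ->
    Cintegral (nu_ n) D f @[n --> F] --> Cintegral nu D f.

Definition asymptotic_density1 (N : set nat) : Prop :=
  (\sum_(1 <= k < n.+1) (k \in N))%N%:R / n%:R @[n --> \oo] --> (1 : R).

End definitions.

(* Main.v *)
Require Import Defs.
From mathcomp Require Import all_boot all_order all_algebra.
From mathcomp Require Import all_classical all_reals all_analysis.
From mathcomp Require Import measurable_realfun complex.
From mathcomp Require Import ring lra.

Set Implicit Arguments.
Unset Strict Implicit.
Unset Printing Implicit Defensive.

Import Order.TTheory GRing.Theory Num.Theory.
Import numFieldNormedType.Exports.
Import ComplexField.Normc.

Local Open Scope classical_set_scope.
Local Open Scope ring_scope.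
Local Open Scope complex_scope.

(** The leading coefficients kappa_n are nondecreasing because |z| <= 1 on the
    support, and regularity together with cap (supp mu) >= 1 gives
    ln kappa_n <= o(n).  Hence, off a set of density 0, the increments
    ln kappa_(n+a) - ln kappa_n tend to 0 for every fixed a.  For such n the
    function z^a p_n is close in L^2(mu) to a multiple of p_(n+a), so the
    moments of |p_n|^2 dmu against z^a conj(z)^b tend to delta_ab, the moments
    of the arc length; Bernstein polynomials in Re z and Im z turn this into
    weak convergence.

    The capacity is at least 1 because the arc length has energy <= 0: the
    function A(y) = int ln |1 - y w|, |y| < 1, satisfies 2 A(y) = A(y^2) and
    A(y) >= ln (1 - |y|), whence A >= 0. *)

(** * Topology of the closed disk *)

(** Regularity controls the increments of ln kappa_n only on average, and single ones may be large;
    this is why a set of density one appears. For a fixed shift, Markov's inequality makes large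
    increments rare; one set serving every shift takes a diagonal choice.

    A small increment suffices because, once leading coefficients are matched, the remainder of z^a
    p_n has degree below n + a and is orthogonal to p_(n+a). By Pythagoras and |z| <= 1 its squared
    norm is at most 1 - (kappa_n / kappa_(n+a))^2. The support may meet the open disk; the diagonal
    moments, tending to 1, are what push the mass of |p_n|^2 dmu to the circle.

    The relation 2 A(y) = A(y^2) rests on the invariance of arc length under w -> -w and w -> w^2.
    Since the logarithm is singular on the circle, the bound A >= 0 is first transferred to ln (|z -
    w| + e), and then e tends to 0. *)

Section complex_topology.
Context {R : realType}.
Implicit Types (u z w : R[i]) (A D : set R[i]).

Lemma normc_sqrtE z : normc z = Num.sqrt (complex.Re z ^+ 2 + complex.Im z ^+ 2).
Proof. by case: z. Qed.

Lemma normc_sqr z : normc z ^+ 2 = complex.Re z ^+ 2 + complex.Im z ^+ 2.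
Proof. by rewrite normc_sqrtE sqr_sqrtr// addr_ge0// sqr_ge0. Qed.

Lemma normc_ge0 z : 0 <= normc z.
Proof. by rewrite normc_sqrtE sqrtr_ge0. Qed.

Lemma normr_Re_le z : `|complex.Re z| <= normc z.
Proof.
rewrite normc_sqrtE -[leLHS]sqrtr_sqr ler_wsqrtr// lerDl; exact: sqr_ge0.
Qed.

Lemma normr_Im_le z : `|complex.Im z| <= normc z.
Proof.
rewrite normc_sqrtE -[leLHS]sqrtr_sqr ler_wsqrtr// lerDr; exact: sqr_ge0.
Qed.

Lemma normc_le_ReIm z : normc z <= `|complex.Re z| + `|complex.Im z|.
Proof.
rewrite -(@ler_pXn2r _ 2)// ?nnegrE ?normc_ge0 ?addr_ge0// normc_sqr sqrrD.
by rewrite !real_normK ?num_real// addrAC lerDl mulrn_wge0// mulr_ge0.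
Qed.

Lemma normc_conjc z : normc z^*%C = normc z.
Proof. by case: z => x y; rewrite /= sqrrN. Qed.

Lemma normc_distC z w : normc (z - w) = normc (w - z).
Proof. by rewrite -(normcN (z - w)) opprB. Qed.

Lemma ler_normcD z w : normc (z + w) <= normc z + normc w.
Proof. exact: le_normcD. Qed.

Lemma ler_normc_distD u z w : normc (z - w) <= normc (z - u) + normc (u - w).
Proof. by rewrite -{1}(subrK u z) -addrA; exact: le_normcD. Qed.

Lemma ler_normc_dist z w : `|normc z - normc w| <= normc (z - w).
Proof.
have H (a b : R[i]) : normc a - normc b <= normc (a - b).
  by rewrite lerBlDr -{1}(subrK b a); exact: le_normcD.
by rewrite ler_norml H andbT lerNl opprB normc_distC H.
Qed.

Lemma normcX z n : normc (z ^+ n) = normc z ^+ n.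
Proof.
elim: n => [|n IH]; first by rewrite !expr0 normc1.
by rewrite !exprS normcM IH.
Qed.

(** Balls of [R[i]] have radii in [R[i]]; positivity forces such a radius to be real, so
    epsilon-delta arguments can be run over [R] with [normc]. *)
Lemma nbhs_normcP z A :
  nbhs z A <-> exists2 e : R, 0 < e & forall w, normc (z - w) < e -> A w.
Proof.
split=> [/nbhs_ballP[e e0 eA]|[e e0 eA]].
  case: e e0 eA => e e' /= /[dup]; rewrite {1}ltcE/= => /andP[/eqP -> e0 _] eA.
  exists e => // w zw; apply: eA; rewrite -ball_normE /= /ball_ /=.
  by rewrite -/(normc _) ltcR.
apply/nbhs_ballP; exists e%:C; first by rewrite /= ltcR.
move=> w; rewrite -ball_normE /= /ball_ /= => zw; apply: eA.
by move: zw; rewrite ltcR.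
Qed.

Lemma closed_unit_diskE z : closed_unit_disk z <-> normc z <= 1.
Proof.
rewrite /closed_unit_disk /= (_ : `|z| = (normc z)%:C)//.
by rewrite (_ : 1 = 1%:C :> R[i])// lecR.
Qed.

Lemma unit_circleE z : unit_circle z <-> normc z = 1.
Proof.
rewrite /unit_circle /= (_ : `|z| = (normc z)%:C)//; split=> [/(congr1 (@complex.Re _))//|->//].
Qed.

Lemma continuous_normcP (f : R[i] -> R) : (forall z (e : R), 0 < e ->
    exists2 d : R, 0 < d & forall w, normc (z - w) < d -> `|f z - f w| < e) ->
  continuous f.
Proof.
move=> fc z; apply/(@cvgrPdist_lt _ _ _ (nbhs z)) => e e0.
by have [d d0 dz] := fc z e e0; apply/nbhs_normcP; exists d.
Qed.

Lemma continuous_Re : continuous (@complex.Re R : R[i] -> R).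
Proof.
apply: continuous_normcP => z e e0; exists e => // w; apply: le_lt_trans.
by case: z w => [x y] [x' y']; exact: normr_Re_le ((x +i* y) - (x' +i* y')).
Qed.

Lemma continuous_Im : continuous (@complex.Im R : R[i] -> R).
Proof.
apply: continuous_normcP => z e e0; exists e => // w; apply: le_lt_trans.
by case: z w => [x y] [x' y']; exact: normr_Im_le ((x +i* y) - (x' +i* y')).
Qed.

Lemma continuousD_real (T : topologicalType) (f g : T -> R) :
  continuous f -> continuous g -> continuous (fun t => f t + g t).
Proof. by move=> fc gc t; apply: cvgD; [exact: fc|exact: gc]. Qed.

Lemma continuousM_real (T : topologicalType) (f g : T -> R) :
  continuous f -> continuous g -> continuous (fun t => f t * g t).
Proof. by move=> fc gc t; apply: cvgM; [exact: fc|exact: gc]. Qed.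

Lemma within_continuousP D (f : R[i] -> R) :
  {within D, continuous f} <-> forall z, D z -> forall e, 0 < e ->
    exists2 d : R, 0 < d &
      forall w, D w -> normc (z - w) < d -> `|f z - f w| < e.
Proof.
rewrite (@subspace_continuousP R[i] D R f); split=> [fc z Dz e e0|fc z Dz].
  have /(@cvgrPdist_lt _ _ _ (within D (nbhs z))) /(_ e e0) := fc z Dz.
  by rewrite /within/= => /nbhs_normcP[d d0 dz]; exists d => // w Dw /dz; exact.
apply/(@cvgrPdist_lt _ _ _ (within D (nbhs z))) => e e0.
have [d d0 dz] := fc z Dz e e0.
by apply/nbhs_normcP; exists d => // w zw Dw; exact: dz.
Qed.

Lemma within_continuousCP D (f : R[i] -> R[i]) :
  {within D, continuous f} -> forall z, D z -> forall e : R, 0 < e ->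
    exists2 d : R, 0 < d &
      forall w, D w -> normc (z - w) < d -> normc (f z - f w) < e.
Proof.
rewrite (@subspace_continuousP R[i] D R[i] f) => fc z Dz e e0.
have : within D (nbhs z) (f @^-1` [set w | normc (f z - w) < e]).
  by apply: (fc z Dz); apply/nbhs_normcP; exists e.
by move=> /nbhs_normcP[d d0 dz]; exists d => // w Dw /dz; exact.
Qed.

Lemma within_continuous_Re D (f : R[i] -> R[i]) :
  {within D, continuous f} -> {within D, continuous (fun z => complex.Re (f z))}.
Proof.
move=> fc; apply/within_continuousP => z Dz e e0.
have [d d0 dz] := within_continuousCP fc Dz e0; exists d => // w Dw /(dz _ Dw).
apply: le_lt_trans; case: (f z) (f w) => [x y] [x' y'].
exact: normr_Re_le ((x +i* y) - (x' +i* y')).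
Qed.

Lemma within_continuous_Im D (f : R[i] -> R[i]) :
  {within D, continuous f} -> {within D, continuous (fun z => complex.Im (f z))}.
Proof.
move=> fc; apply/within_continuousP => z Dz e e0.
have [d d0 dz] := within_continuousCP fc Dz e0; exists d => // w Dw /(dz _ Dw).
apply: le_lt_trans; case: (f z) (f w) => [x y] [x' y'].
exact: normr_Im_le ((x +i* y) - (x' +i* y')).
Qed.

Lemma closed_closed_unit_disk : closed (@closed_unit_disk R).
Proof.
have -> : @closed_unit_disk R = (@normc R) @^-1` [set x | x <= 1].
  by apply/seteqP; split=> z /closed_unit_diskE.
apply: (@closed_comp R[i] R).
  by move=> z _; exact: continuous_normc.
exact: closed_le.
Qed.

(** The topology of [R[i]] comes from its norm, not from a product, so compactness is carried over
    from [R * R] by the continuous map [g]. *)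
Lemma compact_square :
  compact [set z : R[i] | `|complex.Re z| <= 1 /\ `|complex.Im z| <= 1].
Proof.
have cS : compact (`[(-1 : R), 1]%classic `*` `[(-1 : R), 1]%classic).
  by apply: compact_setX; exact: segment_compact.
set g : R * R -> R[i] := fun xy => xy.1 +i* xy.2.
rewrite (_ : [set z | _] = g @` (`[(-1 : R), 1]%classic `*` `[(-1 : R), 1]%classic)); last first.
  apply/seteqP; split=> [[x y] /= [x1 y1]|_ [[x y] /= [x1 y1] <-]] /=.
    by exists (x, y) => //=; rewrite !in_itv/= -!ler_norml.
  by move: x1 y1; rewrite !in_itv/= -!ler_norml.
apply: continuous_compact => //; apply: continuous_subspaceT => -[x y].
move=> A /nbhs_normcP[e e0 eA].
have e20 : 0 < e / 2 by rewrite divr_gt0.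
have : nbhs (x, y) (ball x (e / 2) `*` ball y (e / 2)).
  by exists (ball x (e / 2), ball y (e / 2)) => //=; split; exact: nbhsx_ballx.
apply: filterS => -[x' y'] [/= xx' yy']; apply: eA.
move: xx' yy'; rewrite -!ball_normE /= => xx' yy'.
by apply: le_lt_trans (normc_le_ReIm ((x +i* y) - (x' +i* y'))) _; rewrite /= (splitr e) ltrD.
Qed.

Lemma compact_closed_unit_disk : compact (@closed_unit_disk R).
Proof.
rewrite -(@setIidr _ [set z : R[i] | `|complex.Re z| <= 1 /\ `|complex.Im z| <= 1]
  closed_unit_disk).
  by apply: compact_closedI; [exact: compact_square|exact: closed_closed_unit_disk].
move=> z /closed_unit_diskE z1 /=; split.
- exact: le_trans (normr_Re_le z) z1.
- exact: le_trans (normr_Im_le z) z1.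
Qed.

Lemma within_disk_unif_continuous (f : R[i] -> R) (e : R) :
  {within closed_unit_disk, continuous f} -> 0 < e ->
  exists2 d : R, 0 < d & forall z w, normc z <= 1 -> normc w <= 1 ->
    normc (z - w) < d -> `|f z - f w| < e.
Proof.
move=> /within_continuousP fc e0.
have /compact_near_coveringP cD := compact_closed_unit_disk.
have e20 : 0 < e / 2 by rewrite divr_gt0.
(* Compactness is applied with the modulus [d] as a parameter tending to 0 from the right; halving
   the local modulus keeps both [u] and [w] within it of [z]. *)
have := @cD R (0^'+)
  (fun d z => forall w, normc z <= 1 -> normc w <= 1 -> normc (z - w) < d -> `|f z - f w| < e).
case.
  move=> z Dz; have [d d0 dz] := fc z Dz (e / 2) e20.
  have d20 : 0 < d / 2 by rewrite divr_gt0.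
  exists ([set w | normc (z - w) < d / 2], [set d' | d' < d / 2]) => /=.
    split; first by apply/nbhs_normcP; exists (d / 2).
    exact: nbhs_right_lt.
  move=> [u d'] /= [zu d'd] w u1 w1 uw.
  have /dz H1 : closed_unit_disk u by apply/closed_unit_diskE.
  have /dz H2 : closed_unit_disk w by apply/closed_unit_diskE.
  have {}zu : normc (z - u) < d / 2 := zu.
  have {}d'd : d' < d / 2 := d'd.
  have zu' : normc (z - u) < d by lra.
  have zw' : normc (z - w) < d.
    by have := ler_normc_distD u z w; lra.
  have := ler_distD (f z) (f u) (f w); rewrite (distrC (f u) (f z)).
  have := H1 zu'; have := H2 zw'; lra.
move=> d /= d0 dD.
have /= := dD (d / 2); rewrite sub0r normrN gtr0_norm ?divr_gt0//.
have d2 : d / 2 < d by lra.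
have d20 : 0 < d / 2 by rewrite divr_gt0.
move=> /(_ d2 isT) H; exists (d / 2) => // z w z1 w1 zw.
by apply: H => //; apply/closed_unit_diskE.
Qed.

End complex_topology.

(** * Approximation and convergence of moments *)

Section bernstein.
Context {R : realType}.
Implicit Types (t a b c : R) (g h : nat -> R).

(* The expectation of [g] under the binomial law B(n, t), that is the value at
   [t] of the Bernstein polynomial of the sample [g]. *)
Fixpoint bernstein (n : nat) t g : R :=
  if n is m.+1 then t * bernstein m t (fun j => g j.+1) + (1 - t) * bernstein m t g
  else g 0%N.

Lemma bernstein_dist n t g h a : 0 <= t <= 1 ->
  (forall j, `|g j - a| <= h j) -> `|bernstein n t g - a| <= bernstein n t h.
Proof.
move=> /andP[t0 t1]; elim: n g h => [|n IH] g h gh /=; first exact: gh.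
have -> : t * bernstein n t (fun j => g j.+1) + (1 - t) * bernstein n t g - a =
    t * (bernstein n t (fun j => g j.+1) - a) + (1 - t) * (bernstein n t g - a).
  by ring.
apply: le_trans (ler_normD _ _) _; rewrite !normrM (ger0_norm t0).
rewrite (@ger0_norm _ (1 - t)) ?subr_ge0// lerD// ler_wpM2l ?subr_ge0//.
- exact: IH.
- exact: IH.
Qed.

(** Squared bias plus variance of B(n, t), whose mean is nt and variance nt(1 - t). The centre [c]
    stays free because the recursion shifts it to [c - 1]. *)
Lemma bernstein_sqr n t a b c :
  bernstein n t (fun j => a + b * (j%:R - c) ^+ 2) =
  a + b * ((n%:R * t - c) ^+ 2 + n%:R * t * (1 - t)).
Proof.
elim: n c => [|n IH] c /=; first by rewrite !mul0r addr0.
rewrite [X in t * X](_ : _ = bernstein n t (fun j => a + b * (j%:R - (c - 1)) ^+ 2)).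
  by rewrite !IH -natr1; ring.
by congr bernstein; apply/funext => j; rewrite -natr1; ring.
Qed.

(** A quadratic error bound is averaged exactly by the variance formula, and t(1 - t) <= 1; near and
    far sample points are thus treated together. *)
Lemma bernstein_dist_sqr n t a b g x : (0 < n)%N -> 0 <= b -> 0 <= t <= 1 ->
  (forall j, `|g j - x| <= a + b * (t - j%:R / n%:R) ^+ 2) ->
  `|bernstein n t g - x| <= a + b / n%:R.
Proof.
move=> n0 b0 t01 H.
have nR0 : (n%:R : R) != 0 by rewrite pnatr_eq0 -lt0n.
apply: (@le_trans _ _ (bernstein n t
    (fun j => a + (b / n%:R ^+ 2) * (j%:R - n%:R * t) ^+ 2))).
  apply: bernstein_dist => // j; apply: le_trans (H j) _.
  by rewrite le_eqVlt; apply/orP; left; apply/eqP; field.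
rewrite bernstein_sqr subrr expr0n /= add0r lerD2l.
have -> : b / n%:R ^+ 2 * (n%:R * t * (1 - t)) = (b / n%:R) * (t * (1 - t)) by field.
rewrite -[leRHS]mulr1 ler_wpM2l ?divr_ge0//; case/andP: t01 => *; nra.
Qed.

End bernstein.

(** * Moduli of continuity and the radial retraction *)

Section disk_functions.
Context {R : realType}.
Implicit Types (f g : R[i] -> R) (u v w z : R[i]).

Local Notation D := (@closed_unit_disk R).

Definition disk_continuous f := {within D, continuous f}.

Lemma disk_continuous_within f : continuous f -> disk_continuous f.
Proof. exact: continuous_subspaceT. Qed.

Lemma disk_continuous_cst (c : R) : disk_continuous (fun=> c).
Proof. by apply: disk_continuous_within; exact: cst_continuous. Qed.

Lemma disk_continuousD f g : disk_continuous f -> disk_continuous g ->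
  disk_continuous (fun z => f z + g z).
Proof. by move=> fc gc; exact: (@continuousD_real _ (subspace D)). Qed.

Lemma disk_continuousM f g : disk_continuous f -> disk_continuous g ->
  disk_continuous (fun z => f z * g z).
Proof. by move=> fc gc; exact: (@continuousM_real _ (subspace D)). Qed.

Lemma disk_continuous_bounded f : disk_continuous f ->
  exists2 M : R, 0 <= M & forall z, normc z <= 1 -> `|f z| <= M.
Proof.
move=> /within_continuousP fc.
have /compact_near_coveringP cD := @compact_closed_unit_disk R.
have := @cD R (+oo) (fun M z => normc z <= 1 -> `|f z| <= M).
case.
  move=> z Dz; have [d d0 dz] := fc z Dz 1 ltr01.
  exists ([set w | normc (z - w) < d], [set M | `|f z| + 1 < M]) => /=.
    by split; [apply/nbhs_normcP; exists d | apply: nbhs_pinfty_gt; exact: num_real].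
  move=> [u M] /= [zu zM] /closed_unit_diskE Du.
  have := dz u Du zu; have {}zM : `|f z| + 1 < M := zM.
  have := ler_dist_dist (f z) (f u); rewrite ler_norml; lra.
move=> M [_ /(_ (Num.max (M + 1) 0))] MD; exists (Num.max (M + 1) 0).
  by rewrite le_max lexx orbT.
move=> z z1; apply: MD => //; last by apply/closed_unit_diskE.
by rewrite lt_max; apply/orP; left; lra.
Qed.

(** With d a uniform modulus for e and M a bound of |f|, the constant C = 2M / d^2 makes the
    quadratic term at least 2M when |z - w| >= d. The quadratic shape is the one that the binomial
    variance averages. *)
Lemma disk_continuous_modulus f (e : R) : disk_continuous f -> 0 < e ->
  exists2 C : R, 0 <= C & forall z w, normc z <= 1 -> normc w <= 1 ->
    `|f z - f w| <= e + C * normc (z - w) ^+ 2.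
Proof.
move=> fc e0; have [d d0 dP] := within_disk_unif_continuous fc e0.
have [M M0 MP] := disk_continuous_bounded fc.
exists (2 * M / d ^+ 2); first by rewrite divr_ge0 ?sqr_ge0// mulr_ge0.
move=> z w z1 w1; have [zw|zw] := ltP (normc (z - w)) d.
  apply: le_trans (ltW (dP _ _ z1 w1 zw)) _; rewrite lerDl mulr_ge0 ?sqr_ge0//.
  by rewrite divr_ge0 ?sqr_ge0// mulr_ge0.
have : `|f z - f w| <= 2 * M.
  by apply: le_trans (ler_normB _ _) _; have := MP _ z1; have := MP _ w1; lra.
move=> /le_trans; apply; rewrite -[leLHS]add0r lerD ?(ltW e0)//.
rewrite -mulrA -[leLHS]mulr1 ler_wpM2l ?mulr_ge0// mulrC -expr_div_n -[leLHS](expr1n _ 2).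
by rewrite lerXn2r ?nnegrE// ?divr_ge0 ?normc_ge0 ?(ltW d0)// ler_pdivlMr// mul1r.
Qed.

(** Radial projection onto the disk. Grid points of the square [-1, 1]^2 may lie outside the disk,
    where nothing is known about the function to be approximated. *)
Definition disk_retract v : R[i] :=
  if normc v <= 1 then v else ((normc v)^-1)%:C * v.

Lemma normc_real (x : R) : normc x%:C = `|x|.
Proof. by rewrite /= expr0n /= addr0 sqrtr_sqr. Qed.

Lemma normc_disk_retract v : normc (disk_retract v) <= 1.
Proof.
rewrite /disk_retract; case: ifPn => //; rewrite -ltNge => v1.
have v0 : 0 < normc v by apply: lt_trans v1.
by rewrite normcM normc_real gtr0_norm ?invr_gt0// mulVf// gt_eqF.
Qed.

(** When |v| > 1 the projection moves v by |v| - 1 <= |v| - |z| <= |z - v|; the triangle inequality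
    gives the factor 2. *)
Lemma disk_retract_dist z v : normc z <= 1 ->
  normc (z - disk_retract v) <= 2 * normc (z - v).
Proof.
move=> z1; rewrite /disk_retract; case: ifPn => [_|].
  by have := normc_ge0 (z - v); lra.
rewrite -ltNge => v1; have v0 : 0 < normc v by apply: lt_trans v1.
have H : normc (v - (normc v)^-1%:C * v) = normc v - 1.
  rewrite -{1}[v]mul1r -mulrBl normcM (_ : 1 - _ = (1 - (normc v)^-1)%:C).
    rewrite normc_real ger0_norm; last by rewrite subr_ge0 invf_le1// ltW.
    by rewrite mulrBl mul1r mulVf// gt_eqF.
  by rewrite rmorphB.
apply: le_trans (ler_normc_distD v _ _) _; rewrite H.
have := ler_normc_dist z v; rewrite ler_norml; lra.
Qed.

End disk_functions.

(** * Convergence of functionals on the disk from monomials *)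

Section disk_states.
Context {R : realType}.
Implicit Types (f g h : R[i] -> R) (L : (R[i] -> R) -> R) (z : R[i]).

Definition cmonom (a b : nat) z : R[i] := z ^+ a * (z^*)%C ^+ b.

Lemma Re_cmonomSl a b z : complex.Re (cmonom a.+1 b z) =
  complex.Re z * complex.Re (cmonom a b z) - complex.Im z * complex.Im (cmonom a b z).
Proof.
rewrite /cmonom exprS -mulrA; move: (_ * (_ ^+ b)) => w.
by case: z w => [x y] [x' y'].
Qed.

Lemma Im_cmonomSl a b z : complex.Im (cmonom a.+1 b z) =
  complex.Re z * complex.Im (cmonom a b z) + complex.Im z * complex.Re (cmonom a b z).
Proof.
rewrite /cmonom exprS -mulrA; move: (_ * (_ ^+ b)) => w.
by case: z w => [x y] [x' y'].
Qed.

Lemma Re_cmonomSr a b z : complex.Re (cmonom a b.+1 z) =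
  complex.Re z * complex.Re (cmonom a b z) + complex.Im z * complex.Im (cmonom a b z).
Proof.
rewrite /cmonom exprS mulrCA; move: (_ * (_ ^+ b)) => w.
by case: z w => [x y] [x' y'] /=; rewrite mulNr opprK.
Qed.

Lemma Im_cmonomSr a b z : complex.Im (cmonom a b.+1 z) =
  complex.Re z * complex.Im (cmonom a b z) - complex.Im z * complex.Re (cmonom a b z).
Proof.
rewrite /cmonom exprS mulrCA; move: (_ * (_ ^+ b)) => w.
by case: z w => [x y] [x' y'] /=; rewrite mulNr.
Qed.

Lemma continuous_cmonom a b :
  continuous (fun z : R[i] => complex.Re (cmonom a b z)) /\
  continuous (fun z : R[i] => complex.Im (cmonom a b z)).
Proof.
elim: a => [|a [IHr IHi]].
  elim: b => [|b [IHr IHi]].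
    by rewrite /cmonom; split; under eq_fun do rewrite !expr0 mulr1; exact: cst_continuous.
  split.
  - rewrite (_ : (fun z => _) = fun z => complex.Re z * complex.Re (cmonom 0 b z) +
        complex.Im z * complex.Im (cmonom 0 b z)).
      apply: continuousD_real; apply: continuousM_real => //.
      + exact: continuous_Re.
      + exact: continuous_Im.
    by apply/funext => z; exact: Re_cmonomSr.
  - rewrite (_ : (fun z => _) = fun z => complex.Re z * complex.Im (cmonom 0 b z) +
        (- 1) * (complex.Im z * complex.Re (cmonom 0 b z))).
      apply: continuousD_real; apply: continuousM_real => //.
      + exact: continuous_Re.
      + exact: cst_continuous.
      + apply: continuousM_real => //; exact: continuous_Im.
    by apply/funext => z; rewrite mulN1r; exact: Im_cmonomSr.
split.
- rewrite (_ : (fun z => _) = fun z => complex.Re z * complex.Re (cmonom a b z) +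
      (- 1) * (complex.Im z * complex.Im (cmonom a b z))).
    apply: continuousD_real; apply: continuousM_real => //.
    + exact: continuous_Re.
    + exact: cst_continuous.
    + apply: continuousM_real => //; exact: continuous_Im.
  by apply/funext => z; rewrite mulN1r; exact: Re_cmonomSl.
- rewrite (_ : (fun z => _) = fun z => complex.Re z * complex.Im (cmonom a b z) +
      complex.Im z * complex.Re (cmonom a b z)).
    apply: continuousD_real; apply: continuousM_real => //.
    + exact: continuous_Re.
    + exact: continuous_Im.
  by apply/funext => z; exact: Im_cmonomSl.
Qed.

(* Integration against a subprobability on the disk is a [disk_state], and so is
   [f |-> int f (phi z)]: the convergence criterion below therefore also yields
   the invariance of the arc length under [phi]. *)
Record disk_state L : Prop := DiskState {
  disk_stateD : forall f g, disk_continuous f -> disk_continuous g ->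
    L (fun z => f z + g z) = L f + L g ;
  disk_stateZ : forall (c : R) f, disk_continuous f ->
    L (fun z => c * f z) = c * L f ;
  disk_state_le : forall f (e : R), disk_continuous f ->
    (forall z, normc z <= 1 -> `|f z| <= e) -> `|L f| <= e }.

Lemma disk_state_lin L (c d : R) f g : disk_state L ->
  disk_continuous f -> disk_continuous g ->
  L (fun z => c * f z + d * g z) = c * L f + d * L g.
Proof.
move=> SL fc gc; rewrite (disk_stateD SL) ?(disk_stateZ SL)//;
  by apply: disk_continuousM => //; exact: disk_continuous_cst.
Qed.

Context {T : Type} (F : set_system T) {FF : Filter F}
  (L_ : T -> (R[i] -> R) -> R) (L : (R[i] -> R) -> R).
Hypothesis SL_ : forall t, disk_state (L_ t).
Hypothesis SL : disk_state L.

(* [good] is stable under multiplication by [Re z] and [Im z], which only shift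
   the exponents of the monomials. *)
Let good h := disk_continuous h /\ forall a b,
  (L_ t (fun z => complex.Re (cmonom a b z) * h z) @[t --> F] -->
   L (fun z => complex.Re (cmonom a b z) * h z)) /\
  (L_ t (fun z => complex.Im (cmonom a b z) * h z) @[t --> F] -->
   L (fun z => complex.Im (cmonom a b z) * h z)).

Let good_cvg_lin (c d : R) f g : disk_continuous f -> disk_continuous g ->
  L_ t f @[t --> F] --> L f -> L_ t g @[t --> F] --> L g ->
  L_ t (fun z => c * f z + d * g z) @[t --> F] --> L (fun z => c * f z + d * g z).
Proof.
move=> fc gc cf cg; rewrite disk_state_lin//.
rewrite (_ : (fun t => _) = fun t => c * L_ t f + d * L_ t g).
  by apply: cvgD; apply: cvgM => //; exact: cvg_cst.
by apply/funext => t; rewrite disk_state_lin.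
Qed.

Let good_Re_continuous a b h : disk_continuous h ->
  disk_continuous (fun z => complex.Re (cmonom a b z) * h z).
Proof.
by move=> hc; apply: disk_continuousM => //; apply: disk_continuous_within;
  exact: (continuous_cmonom a b).1.
Qed.

Let good_Im_continuous a b h : disk_continuous h ->
  disk_continuous (fun z => complex.Im (cmonom a b z) * h z).
Proof.
by move=> hc; apply: disk_continuousM => //; apply: disk_continuous_within;
  exact: (continuous_cmonom a b).2.
Qed.

Let good_lin (c d : R) f g : good f -> good g -> good (fun z => c * f z + d * g z).
Proof.
move=> [fc fG] [gc gG]; split.
  by apply: disk_continuousD; apply: disk_continuousM => //; exact: disk_continuous_cst.
move=> a b; split.
- rewrite (_ : (fun z => _) = (fun z => c * (complex.Re (cmonom a b z) * f z) +
     d * (complex.Re (cmonom a b z) * g z))); last by apply/funext => z; ring.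
  by apply: good_cvg_lin; [exact: good_Re_continuous..|exact: (fG a b).1|exact: (gG a b).1].
- rewrite (_ : (fun z => _) = (fun z => c * (complex.Im (cmonom a b z) * f z) +
     d * (complex.Im (cmonom a b z) * g z))); last by apply/funext => z; ring.
  by apply: good_cvg_lin; [exact: good_Im_continuous..|exact: (fG a b).2|exact: (gG a b).2].
Qed.

(** 2 Re z = z + conj z: the product with a monomial is the mean of the two monomials with one
    exponent raised. *)
Let good_Re h : good h -> good (fun z => complex.Re z * h z).
Proof.
move=> [hc hG]; split.
  by apply: disk_continuousM => //; apply: disk_continuous_within; exact: continuous_Re.
move=> a b; split.
- rewrite (_ : (fun z => _) = (fun z => 2^-1 * (complex.Re (cmonom a.+1 b z) * h z) +
     2^-1 * (complex.Re (cmonom a b.+1 z) * h z))).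
    by apply: good_cvg_lin; [exact: good_Re_continuous..|exact: (hG _ _).1|exact: (hG _ _).1].
  by apply/funext => z; rewrite Re_cmonomSl Re_cmonomSr; field.
- rewrite (_ : (fun z => _) = (fun z => 2^-1 * (complex.Im (cmonom a.+1 b z) * h z) +
     2^-1 * (complex.Im (cmonom a b.+1 z) * h z))).
    by apply: good_cvg_lin; [exact: good_Im_continuous..|exact: (hG _ _).2|exact: (hG _ _).2].
  by apply/funext => z; rewrite Im_cmonomSl Im_cmonomSr; field.
Qed.

(** 2i Im z = z - conj z; the factor i exchanges real and imaginary moments. *)
Let good_Im h : good h -> good (fun z => complex.Im z * h z).
Proof.
move=> [hc hG]; split.
  by apply: disk_continuousM => //; apply: disk_continuous_within; exact: continuous_Im.
move=> a b; split.
- rewrite (_ : (fun z => _) = (fun z => 2^-1 * (complex.Im (cmonom a.+1 b z) * h z) +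
     (- 2^-1) * (complex.Im (cmonom a b.+1 z) * h z))).
    by apply: good_cvg_lin; [exact: good_Im_continuous..|exact: (hG _ _).2|exact: (hG _ _).2].
  by apply/funext => z; rewrite Im_cmonomSl Im_cmonomSr; field.
- rewrite (_ : (fun z => _) = (fun z => 2^-1 * (complex.Re (cmonom a b.+1 z) * h z) +
     (- 2^-1) * (complex.Re (cmonom a.+1 b z) * h z))).
    by apply: good_cvg_lin; [exact: good_Re_continuous..|exact: (hG _ _).1|exact: (hG _ _).1].
  by apply/funext => z; rewrite Re_cmonomSl Re_cmonomSr; field.
Qed.

(** The samples are functions of z, so the lemma can be nested, with k = Im inside k = Re; (1 + k z)
    / 2 moves the range [-1, 1] of k on the disk to [0, 1]. *)
Let good_bernstein n (k : R[i] -> R) (g : nat -> R[i] -> R) :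
  (forall h, good h -> good (fun z => k z * h z)) -> (forall j, good (g j)) ->
  good (fun z => bernstein n ((1 + k z) / 2) (fun j => g j z)).
Proof.
move=> kG; elim: n g => [|n IH] g gG /=; first exact: gG.
rewrite (_ : (fun z => _) = fun z =>
  1 * (2^-1 * bernstein n ((1 + k z) / 2) (fun j => g j.+1 z) +
       2^-1 * (k z * bernstein n ((1 + k z) / 2) (fun j => g j.+1 z))) +
  1 * (2^-1 * bernstein n ((1 + k z) / 2) (fun j => g j z) +
       (- 2^-1) * (k z * bernstein n ((1 + k z) / 2) (fun j => g j z)))).
  have H1 := IH _ gG.
  have H2 := IH (fun j => g j.+1) (fun j => gG j.+1).
  by apply: good_lin; apply: good_lin => //; exact: kG.
by apply/funext => z; field.
Qed.

Hypothesis cvg_cmonom : forall a b,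
  L_ t (fun z => complex.Re (cmonom a b z)) @[t --> F] -->
    L (fun z => complex.Re (cmonom a b z)) /\
  L_ t (fun z => complex.Im (cmonom a b z)) @[t --> F] -->
    L (fun z => complex.Im (cmonom a b z)).

Let good_cst (c : R) : good (fun=> c).
Proof.
have G1 : good (fun=> 1).
  split; first exact: disk_continuous_cst.
  move=> a b; rewrite (_ : (fun z => _ * 1) = fun z => complex.Re (cmonom a b z)).
    rewrite (_ : (fun z => _ * 1) = fun z => complex.Im (cmonom a b z)).
      exact: cvg_cmonom.
    by apply/funext => z; rewrite mulr1.
  by apply/funext => z; rewrite mulr1.
rewrite (_ : (fun=> c) = fun z => c * 1 + 0 * 1); first exact: good_lin.
by apply/funext => z; rewrite mulr1 mul0r addr0.
Qed.

Let good_dense f (e : R) : disk_continuous f -> 0 < e -> exists2 P, good P &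
  forall z, normc z <= 1 -> `|f z - P z| <= e.
Proof.
move=> fc e0; have e20 : 0 < e / 2 by rewrite divr_gt0.
have [C C0 CP] := disk_continuous_modulus fc e20.
(* The retraction gives 4C |z - v|^2, and a coordinate differs from its node by 2 (t - j / n),
   whence 16C; each of the two variables then costs 16C / n. *)
have [n [n0 nC]] : exists n, (0 < n)%N /\ 32 * C / n%:R <= e / 2.
  exists (Num.truncn (64 * C / e)).+1; split=> //.
  have := truncnS_gt (64 * C / e); rewrite ltr_pdivrMr// ler_pdivrMr//.
  by move: ((Num.truncn _).+1%:R) => m; lra.
pose u j : R := 2 * (j%:R / n%:R) - 1.
pose P z := bernstein n ((1 + complex.Re z) / 2) (fun j =>
  bernstein n ((1 + complex.Im z) / 2) (fun k => f (disk_retract (u j +i* u k)))).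
exists P.
  apply: good_bernstein => [h|j]; first exact: good_Re.
  apply: (@good_bernstein n (@complex.Im R) (fun k => fun=> f (disk_retract (u j +i* u k)))).
  - exact: good_Im.
  - move=> k; exact: good_cst.
move=> z z1; rewrite distrC.
have /andP[x0 x1] : - normc z <= complex.Re z <= normc z.
  by rewrite -ler_norml normr_Re_le.
have /andP[y0 y1] : - normc z <= complex.Im z <= normc z.
  by rewrite -ler_norml normr_Im_le.
have main j k : `|f (disk_retract (u j +i* u k)) - f z| <=
    e / 2 + 16 * C * ((1 + complex.Re z) / 2 - j%:R / n%:R) ^+ 2 +
    16 * C * ((1 + complex.Im z) / 2 - k%:R / n%:R) ^+ 2.
  rewrite distrC; apply: le_trans (CP _ _ z1 (normc_disk_retract _)) _.
  rewrite -addrA lerD2l; have := disk_retract_dist (u j +i* u k) z1.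
  have := normc_ge0 (z - disk_retract (u j +i* u k)).
  have := normc_sqr (z - (u j +i* u k)).
  rewrite (_ : complex.Re (_ - _) = complex.Re z - u j); last by case: (z).
  rewrite (_ : complex.Im (_ - _) = complex.Im z - u k); last by case: (z).
  rewrite /u; move: (normc _) (normc _) => q p pE q0 qp.
  have H : q ^+ 2 <= 4 * p ^+ 2.
    by nra.
  have := ler_wpM2l C0 H; rewrite pE => /le_trans; apply.
  by rewrite le_eqVlt; apply/orP; left; apply/eqP; field;
    rewrite pnatr_eq0 -lt0n.
have inner j : `|bernstein n ((1 + complex.Im z) / 2)
      (fun k => f (disk_retract (u j +i* u k))) - f z| <=
    (e / 2 + 16 * C / n%:R) + 16 * C * ((1 + complex.Re z) / 2 - j%:R / n%:R) ^+ 2.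
  rewrite addrAC; apply: bernstein_dist_sqr => //; first by rewrite mulr_ge0.
  by apply/andP; split; lra.
have C16 : 0 <= 16 * C by rewrite mulr_ge0.
have t01 : 0 <= (1 + complex.Re z) / 2 <= 1 by apply/andP; split; lra.
have := bernstein_dist_sqr n0 C16 t01 inner; rewrite -/(P z) => /le_trans; apply.
have -> : e / 2 + 16 * C / n%:R + 16 * C / n%:R = e / 2 + 32 * C / n%:R by ring.
by lra.
Qed.

(** The bound [disk_state_le] makes the error of replacing f by P uniform in t, so convergence at a
    single good P is enough. *)
Lemma disk_state_cvg f : disk_continuous f -> L_ t f @[t --> F] --> L f.
Proof.
move=> fc; apply/cvgrPdist_le => e e0.
have e30 : 0 < e / 3 by rewrite divr_gt0.
have [P PG fP] := good_dense fc e30.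
have cP : L_ t P @[t --> F] --> L P.
  have := (PG.2 0%N 0%N).1.
  rewrite (_ : (fun z => _ * P z) = P)//; apply/funext => z.
  by rewrite /cmonom !expr0 mulr1 /= mul1r.
have bnd K : disk_state K -> `|K f - K P| <= e / 3.
  move=> SK; have -> : K f - K P = K (fun z => 1 * f z + (-1) * P z).
    by rewrite (disk_state_lin _ _ SK fc PG.1) mul1r mulN1r.
  apply: (disk_state_le SK).
    by apply: disk_continuousD; apply: disk_continuousM;
      [exact: disk_continuous_cst|exact: fc|exact: disk_continuous_cst|exact: PG.1].
  by move=> z z1; rewrite mul1r mulN1r; exact: fP.
have /cvgrPdist_le /(_ _ e30) := cP; apply: filterS => t Pt.
have := bnd _ SL; have := bnd _ (SL_ t); rewrite !ler_norml in Pt *.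
by move=> *; apply/andP; split; lra.
Qed.

End disk_states.

(** * Measures on the closed disk *)

Section disk_measures.
Context {R : realType}.
Implicit Types (f g : R[i] -> R) (z : R[i]).

Local Notation D := (@closed_unit_disk R).

Lemma measurable_closed_unit_disk : measurable D.
Proof.
rewrite -[D]setCK; apply: measurableC; apply: sub_sigma_algebra.
exact/closed_openC/closed_closed_unit_disk.
Qed.

Lemma measurable_fun_disk_continuous f :
  disk_continuous f -> measurable_fun D f.
Proof.
move=> /within_continuousP fc mD.
apply: (measurability _ (RGenOpens.measurableE R)) => // _ [_ [a [b ->]] <-].
(* Continuity is only relative to the disk, so the preimage of an interval is the trace of an open
   set of the plane: the interior of its union with the complement of the disk. *)
rewrite (_ : _ `&` _ = D `&` interior (~` D `|` f @^-1` `]a, b[%classic)).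
  apply: measurableI; first exact: mD.
  apply: sub_sigma_algebra; exact: open_interior.
apply/seteqP; split=> [z [Dz fz]|z [Dz /interior_subset[|]]]//; split=> //.
have : nbhs (f z) `]a, b[%classic by apply: open_nbhs_nbhs; split=> //; exact: interval_open.
move=> /nbhs_ballP[e /= e0 eab].
have [d d0 dz] := fc z Dz e e0.
apply/nbhs_normcP; exists d => // w zw; have [Dw|] := pselect (D w); last by left.
by right; apply: eab; exact: dz.
Qed.

Lemma disk_integrable (nu : {measure set R[i] -> \bar R}) f :
  (nu D < +oo)%E -> disk_continuous f -> nu.-integrable D (EFin \o f).
Proof.
move=> nuD fc; have [M M0 MP] := disk_continuous_bounded fc.
apply: measurable_bounded_integrable => //.
- exact: measurable_closed_unit_disk.
- exact: measurable_fun_disk_continuous.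
- exists M; split; first exact: num_real.
  move=> x Mx z /closed_unit_diskE z1; exact: le_trans (MP _ z1) (ltW Mx).
Qed.

Lemma disk_state_Rintegral (nu : {measure set R[i] -> \bar R}) :
  (nu D <= 1)%E -> disk_state (fun f => \int[nu]_(z in D) f z).
Proof.
move=> nuD; have nuy : (nu D < +oo)%E by apply: le_lt_trans nuD _; rewrite ltry.
have mD := measurable_closed_unit_disk.
split=> [f g fc gc|c f fc|f e fc fe].
- by rewrite RintegralD//; exact: disk_integrable.
- by rewrite RintegralZl//; exact: disk_integrable.
- apply: le_trans (le_normr_Rintegral _ _) _ => //; first exact: disk_integrable.
  have e0 : 0 <= e.
    by apply: le_trans (fe 0 _); rewrite ?normr_ge0// normc0.
  apply: (@le_trans _ _ (\int[nu]_(z in D) e)).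
    apply: le_Rintegral => //.
    + have := disk_integrable nuy fc => /integrable_abse; exact.
    + by apply: disk_integrable => //; exact: disk_continuous_cst.
    + by move=> z /closed_unit_diskE; exact: fe.
  rewrite Rintegral_cst// -[leRHS]mulr1 ler_wpM2l// -lee_fin fineK//.
  by rewrite ge0_fin_numE.
Qed.

Lemma cvg_complex (T : Type) (F : set_system T) {FF : Filter F}
    (f g : T -> R) (a b : R) :
  f t @[t --> F] --> a -> g t @[t --> F] --> b ->
  (f t +i* g t : R[i]) @[t --> F] --> (a +i* b : R[i]).
Proof.
move=> fa gb A /nbhs_normcP[e e0 eA].
have e20 : 0 < e / 2 by rewrite divr_gt0.
move: fa => /cvgrPdist_lt/(_ _ e20) fa.
move: gb => /cvgrPdist_lt/(_ _ e20) gb.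
apply: filterS2 fa gb => t af bg; apply: eA.
by apply: le_lt_trans (normc_le_ReIm ((a +i* b) - (f t +i* g t))) _; rewrite /= (splitr e) ltrD.
Qed.

Lemma cvg_Re_Im (T : Type) (F : set_system T) {FF : Filter F}
    (f : T -> R[i]) (a : R[i]) :
  f t @[t --> F] --> a ->
  complex.Re (f t) @[t --> F] --> complex.Re a /\
  complex.Im (f t) @[t --> F] --> complex.Im a.
Proof.
move=> fa; split; apply: (cvg_comp _ _ fa).
- exact: continuous_Re.
- exact: continuous_Im.
Qed.

Lemma disk_weak_cvg (F : set_system nat) {FF : Filter F}
    (nu_ : nat -> {measure set R[i] -> \bar R}) (nu : {measure set R[i] -> \bar R}) :
  (forall n, (nu_ n D <= 1)%E) -> (nu D <= 1)%E ->
  (forall a b, Cintegral (nu_ n) D (cmonom a b) @[n --> F] -->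
     Cintegral nu D (cmonom a b)) ->
  weak_cvg D F nu_ nu.
Proof.
move=> nu_1 nu1 Hm f fc.
have H g : disk_continuous g -> \int[nu_ n]_(z in D) g z @[n --> F] -->
    \int[nu]_(z in D) g z.
  apply: (@disk_state_cvg R nat F FF (fun n g => \int[nu_ n]_(z in D) g z)
     (fun g => \int[nu]_(z in D) g z)).
  - by move=> n; exact: disk_state_Rintegral.
  - exact: disk_state_Rintegral.
  - move=> a b; exact: cvg_Re_Im (Hm a b).
apply: cvg_complex; apply: H.
- exact: within_continuous_Re.
- exact: within_continuous_Im.
Qed.

End disk_measures.

(** * Integration against a measure with a density *)

Section density.
Local Open Scope ereal_scope.
Context d (T : measurableType d) (R : realType).
Variables (mu nu : {measure set T -> \bar R}) (g : T -> \bar R).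
Hypothesis gfin : forall x, g x \is a fin_num.
Hypothesis mg : measurable_fun setT g.
Hypothesis g0 : forall x, 0 <= g x.
Hypothesis nug : forall E, measurable E -> nu E = \int[mu]_(x in E) g x.

Let integral_density_indic E : measurable E ->
  \int[nu]_x (\1_E x)%:E = \int[mu]_x ((\1_E x)%:E * g x).
Proof.
move=> mE; rewrite integral_indic// setIT nug// integral_mkcond.
apply: eq_integral => x _; rewrite patchE indicE.
by case: ifPn => xE; rewrite ?mul1e ?mul0e.
Qed.

Import HBNNSimple.

Let integral_density_nnsfun (h : {nnsfun T >-> R}) :
  \int[nu]_x (h x)%:E = \int[mu]_x ((h x)%:E * g x).
Proof.
under [LHS]eq_integral do rewrite fimfunE -fsumEFin//.
rewrite [LHS]ge0_integral_fsum//; last 2 first.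
  - by move=> r; exact/measurable_EFinP/measurableT_comp.
  - by move=> n x _; rewrite EFinM nnfun_muleindic_ge0.
under [RHS]eq_integral.
  move=> x xD; rewrite fimfunE -fsumEFin// ge0_mule_fsuml; last first.
    by move=> r; rewrite EFinM nnfun_muleindic_ge0.
  over.
rewrite [RHS]ge0_integral_fsum//; last 2 first.
  - move=> r; apply: emeasurable_funM => //.
    by apply/measurable_EFinP; apply/measurableT_comp.
  - by move=> n x _; rewrite mule_ge0// EFinM nnfun_muleindic_ge0.
apply: eq_fsbigr => r /set_mem [t _ <-]; rewrite !integralZl_indic_nnsfun//=.
rewrite -[RHS](_ : \int[mu]_x ((h t)%:E * ((\1_(h @^-1` [set h t]) x)%:E * g x)) = _); last first.
  by apply: eq_integral => x _; rewrite EFinM muleA.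
rewrite ge0_integralZl//.
- by rewrite -integral_density_indic// integral_indic.
- by apply: emeasurable_funM => //; exact/measurable_EFinP.
- by move=> x _; rewrite mule_ge0// lee_fin.
- by rewrite lee_fin.
Qed.

(** Extension by zero off D reduces to the whole space; there the formula passes from indicators to
    simple functions and, by monotone convergence, to f. *)
Lemma ge0_integral_density (f : T -> \bar R) (D : set T) : measurable D ->
  measurable_fun D f -> (forall x, D x -> 0 <= f x) ->
  \int[nu]_(x in D) f x = \int[mu]_(x in D) (f x * g x).
Proof.
move=> mD mf f0; rewrite [LHS]integral_mkcond [RHS]integral_mkcond.
rewrite [RHS](_ : _ = \int[mu]_x ((f \_ D) x * g x)); last first.
  by apply: eq_integral => x _; rewrite !patchE; case: ifPn => // _; rewrite mul0e.
have {}f0 x : 0 <= (f \_ D) x.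
  by rewrite patchE; case: ifPn => // /set_mem; exact: f0.
move/(measurable_restrictT _ mD) : mf f0; move: (f \_ D) => {}f mf f0.
pose f_ := nnsfun_approx measurableT mf.
transitivity (lim (\int[nu]_x (f_ n x)%:E @[n --> \oo])).
  rewrite -monotone_convergence//=.
  - apply: eq_integral => ? /[!inE] xD; apply/esym/cvg_lim => //=.
    exact: cvg_nnsfun_approx.
  - by move=> n; exact/measurable_EFinP/measurable_funTS.
  - by move=> n ? _; rewrite lee_fin.
  - by move=> ? _ ? ? mn; rewrite lee_fin; exact/lefP/nd_nnsfun_approx.
rewrite [RHS](_ : _ = lim (\int[mu]_x ((f_ n x)%:E * g x) @[n --> \oo])); last first.
  rewrite -monotone_convergence//=.
  - apply: eq_integral => x _; apply/esym/cvg_lim => //.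
    by apply: cvgeZr => //; exact: cvg_nnsfun_approx.
  - move=> n; apply: emeasurable_funM => //.
    exact/measurable_EFinP/measurable_funTS.
  - by move=> n x _; rewrite mule_ge0// lee_fin.
  - move=> x _ ? ? mn; rewrite lee_wpmul2r// lee_fin; exact/lefP/nd_nnsfun_approx.
by apply: congr_lim; apply/funext => n /=; exact: integral_density_nnsfun.
Qed.

End density.

(** * Integrals against |p|^2 dmu *)

Section sqnorm.
Context {R : realType}.
Local Notation D := (@closed_unit_disk R).

(** As |p|^2 >= 0, the positive and negative parts of f |p|^2 are those of f times |p|^2, and the
    density formula applies to each. *)
Lemma Rintegral_sqnorm_measure (mu : {finite_measure set R[i] -> \bar R})
    (p : {poly R[i]}) (f : R[i] -> R) : disk_continuous f ->
  \int[sqnorm_measure mu p]_(z in D) f z =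
  \int[mu]_(z in D) (f z * normc p.[z] ^+ 2).
Proof.
move=> fc; have mD := @measurable_closed_unit_disk R.
have mf := measurable_fun_disk_continuous fc.
have H (h : R[i] -> \bar R) : measurable_fun D h -> (forall z, D z -> (0 <= h z)%E) ->
    (\int[sqnorm_measure mu p]_(z in D) h z =
    \int[mu]_(z in D) (h z * (normc p.[z] ^+ 2)%:E))%E.
  move=> mh h0; apply: ge0_integral_density => //.
  - exact: measurable_sqnorm_poly.
  - by move=> z; rewrite lee_fin sqr_ge0.
rewrite /Rintegral; congr fine.
rewrite [LHS]integralE [RHS]integralE !H//; last 2 first.
- by apply: measurable_funeneg; exact/measurable_EFinP.
- by apply: measurable_funepos; exact/measurable_EFinP.
congr (_ - _)%E; apply: eq_integral => z _; rewrite ?funeposE ?funenegE.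
- by rewrite -!EFin_max -EFinM maxr_pMl ?sqr_ge0// mul0r.
- by rewrite -!EFinN -!EFin_max -EFinM maxr_pMl ?sqr_ge0// mul0r mulNr.
Qed.

End sqnorm.

(** * Arc length and its logarithmic energy *)

Section arclength_moments.
Context {R : realType}.
Implicit Types (t s : R) (f F : R -> R).

Local Notation D := (@closed_unit_disk R).
Local Notation U := (uniform_prob (@pi2_gt0 R)).

Lemma normc_expi t : normc (expi t) = 1.
Proof. by rewrite /expi /= cos2Dsin2 sqrtr1. Qed.

Lemma expiD t s : expi (t + s) = expi t * expi s.
Proof.
apply/eqP; rewrite eq_complex /= cosD sinD eqxx /=.
by apply/eqP; rewrite addrC.
Qed.

Lemma expi0 : expi 0 = 1 :> R[i].
Proof. by rewrite /expi cos0 sin0. Qed.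

Lemma expi_2pi : expi (2 * pi) = 1 :> R[i].
Proof. by rewrite /expi mulr_natl cos2pi sin2pi. Qed.

Lemma expiX t n : expi t ^+ n = expi (n%:R * t).
Proof.
elim: n => [|n IH]; first by rewrite expr0 mul0r expi0.
by rewrite exprS IH -expiD -natr1 mulrDl mul1r addrC.
Qed.

Lemma conjc_expi t : (expi t)^*%C = expi (- t).
Proof. by rewrite /expi cosN sinN. Qed.

Lemma cmonom_expi a b t : cmonom a b (expi t) = expi ((a%:R - b%:R) * t).
Proof. by rewrite /cmonom conjc_expi !expiX -expiD mulrN mulrBl. Qed.

Lemma integrable_expi (f : R[i] -> R) : disk_continuous f ->
  U.-integrable setT (fun t => (f (expi t))%:E).
Proof.
move=> fc; have mf := measurable_fun_disk_continuous fc.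
have DE t : D (expi t) by apply/closed_unit_diskE; rewrite normc_expi.
have mD := @measurable_closed_unit_disk R.
have mfD : measurable_fun setT (f \_ D) by apply/(measurable_restrictT _ mD).
rewrite (_ : (fun t => _) = EFin \o ((f \_ D) \o (@expi R))); last first.
  by apply/funext => t; rewrite /= patchE mem_set.
have [M M0 MP] := disk_continuous_bounded fc.
apply: measurable_bounded_integrable => //.
- by rewrite [ltLHS](_ : _ = 1%E) ?ltry//; exact: probability_setT.
- by apply: measurableT_comp => //; exact: measurable_expi.
- exists M; split; first exact: num_real.
  move=> x Mx t _ /=; rewrite patchE mem_set//.
  apply: le_trans (MP _ _) (ltW Mx); by rewrite normc_expi.
Qed.

Lemma Rintegral_arclength (f : R[i] -> R) : disk_continuous f ->
  \int[arclength]_(z in D) f z = \int[U]_t f (expi t).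
Proof.
move=> fc; have mD := @measurable_closed_unit_disk R.
have mf := measurable_fun_disk_continuous fc.
have DE t : D (expi t) by apply/closed_unit_diskE; rewrite normc_expi.
have mfD : measurable_fun setT (f \_ D) by apply/(measurable_restrictT _ mD).
rewrite Rintegral_mkcond /Rintegral; congr fine.
have intf : U.-integrable (@expi R @^-1` setT) ((EFin \o (f \_ D)) \o (@expi R)).
  rewrite preimage_setT (_ : _ \o _ = fun t => (f (expi t))%:E).
    exact: integrable_expi.
  by apply/funext => t; rewrite /= patchE mem_set.
have mE : measurable_fun setT (EFin \o (f \_ D)) by exact/measurable_EFinP.
have := @integral_pushforward _ _ (g_sigma_algebraType R.-ocitv.-measurable) _ _ _ (@measurable_expi R) U setT _ mE intf measurableT.
rewrite preimage_setT => H; transitivity (\int[U]_t ((f \_ D) (expi t))%:E)%E; first exact: H.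
by apply: eq_integral => t _; rewrite patchE mem_set.
Qed.

Lemma Rintegral_uniform_cst (c : R) : \int[U]_t c = c.
Proof.
rewrite Rintegral_cst// [X in fine X](_ : _ = 1%E) ?mulr1//.
exact: probability_setT.
Qed.

Lemma Rintegral_uniform_derive f F : continuous f -> (forall t, `|f t| <= 1) ->
  (forall t, is_derive t 1 F (f t)) -> F 0 = F (2 * pi) ->
  \int[U]_t f t = 0.
Proof.
move=> fc f1 dF F0.
have mf : measurable_fun setT f by exact: continuous_measurable_fun.
have U1 : U setT = 1%E by exact: probability_setT.
have intf : U.-integrable setT (EFin \o f).
  apply: measurable_bounded_integrable => //; 
    first by rewrite [ltLHS](_ : _ = 1%E) ?ltry.
  by exists 1; split; [exact: num_real|move=> x x1 t _; exact: le_trans (f1 t) (ltW x1)].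
have int1 : U.-integrable setT (EFin \o cst (1 : R)).
  apply: measurable_bounded_integrable => //; 
    first by rewrite [ltLHS](_ : _ = 1%E) ?ltry.
  by exists 1; split; [exact: num_real|move=> x x1 t _; rewrite /= normr1 ltW].
have dFt t : is_derive t 1 (fun t => F t + t) (f t + 1).
  exact: is_deriveD (dF t) (is_derive_id t (1 : R)).
(* [integral_uniform] is applied to a nonnegative integrand, hence the shift by 1, with
   antiderivative F t + t. *)
have : \int[U]_t (f t + 1) = 1.
  rewrite /Rintegral integral_uniform; last 2 first.
  - apply/measurable_EFinP; apply: measurable_funD => //.
  - by move=> t; rewrite lee_fin; have := f1 t; rewrite ler_norml; lra.
  rewrite (@continuous_FTC2 _ _ (fun t => F t + t)) //.
  - rewrite /= F0 !subr0 addr0 addrAC subrr add0r mulVf//.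
    by rewrite gt_eqF// pi2_gt0.
  - exact: pi2_gt0.
  - apply: continuous_subspaceT => t; apply: cvgD; [exact: fc|exact: cvg_cst].
  - have dc : continuous (fun t => F t + t).
      move=> t; apply: differentiable_continuous; apply/derivable1_diffP.
      exact: (@ex_derive _ _ _ _ _ _ _ (dFt t)).
    split; first by move=> t _; exact: (@ex_derive _ _ _ _ _ _ _ (dFt t)).
    + by apply: cvg_at_right_filter; exact: dc.
    + by apply: cvg_at_left_filter; exact: dc.
  - by move=> t _; rewrite derive1E (@derive_val _ _ _ _ _ _ _ (dFt t)).
rewrite RintegralD// Rintegral_uniform_cst => /eqP.
by rewrite -subr_eq0 addrK => /eqP.
Qed.

Lemma Cintegral_arclength_cmonom a b :
  Cintegral arclength D (cmonom a b) = (a == b)%:R.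
Proof.
have [cR cI] := @continuous_cmonom R a b.
rewrite /Cintegral !Rintegral_arclength; [|exact: disk_continuous_within..].
have U1 : U setT = 1%E by exact: probability_setT.
under eq_Rintegral do rewrite cmonom_expi /=.
under [X in _ +i* X]eq_Rintegral do rewrite cmonom_expi /=.
have [->|ab] := eqVneq a b.
  under eq_Rintegral do rewrite subrr mul0r cos0.
  under [X in _ +i* X]eq_Rintegral do rewrite subrr mul0r sin0.
  by rewrite !Rintegral_uniform_cst.
set r : R := a%:R - b%:R.
have r0 : r != 0 by rewrite subr_eq0 eqr_nat.
(* The difference r = a - b may be negative, so periodicity is read off the monomial: it equals 1 at
   t = 2 pi, whence cos (2 pi r) = 1 and sin (2 pi r) = 0. *)
have /eqP := cmonom_expi a b (2 * pi).
rewrite expi_2pi /cmonom !conjc1 !expr1n mulr1 -/r eq_complex /= => /andP[/eqP c2 /eqP s2].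
have dlin t : is_derive t 1 (fun t => r * t) r.
  have := is_deriveZ r (is_derive_id t (1 : R)); rewrite [X in is_derive _ _ _ X]mulr1.
  exact.
have clin : continuous (fun t : R => r * t).
  by move=> t; apply: cvgM; [exact: cvg_cst|exact: cvg_id].
have -> : \int[U]_t cos (r * t) = 0.
  apply: (@Rintegral_uniform_derive _ (fun t => r^-1 * sin (r * t))).
  - move=> t; apply: (@continuous_comp _ _ _ (fun t => r * t)); first exact: clin.
    exact: continuous_cos.
  - by move=> t; rewrite ler_norml cos_geN1 cos_le1.
  - move=> t; have := is_deriveZ r^-1 (is_derive1_comp (is_derive_sin (r * t)) (dlin t)).
    by rewrite [X in is_derive _ _ _ X](_ : _ = cos (r * t))// /GRing.scale /=; field.
  - by rewrite /= -s2 !mulr0 sin0 mulr0.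
have -> : \int[U]_t sin (r * t) = 0.
  apply: (@Rintegral_uniform_derive _ (fun t => - r^-1 * cos (r * t))).
  - move=> t; apply: (@continuous_comp _ _ _ (fun t => r * t)); first exact: clin.
    exact: continuous_sin.
  - by move=> t; rewrite ler_norml sin_geN1 sin_le1.
  - move=> t; have := is_deriveZ (- r^-1) (is_derive1_comp (is_derive_cos (r * t)) (dlin t)).
    by rewrite [X in is_derive _ _ _ X](_ : _ = sin (r * t))// /GRing.scale /=; field.
  - by rewrite /= mulr0 cos0 -c2.
by [].
Qed.

End arclength_moments.

(** * Integrals of ln |1 - y w| over the circle *)

Section log_potential.
Context {R : realType}.
Implicit Types (f : R[i] -> R) (y z w : R[i]) (phi : R[i] -> R[i]).

Local Notation D := (@closed_unit_disk R).
Local Notation U := (uniform_prob (@pi2_gt0 R)).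

Lemma arclength_disk : arclength D = 1%E.
Proof.
rewrite /arclength /pushforward (_ : _ @^-1` _ = setT); first exact: probability_setT.
by apply/seteqP; split=> // t _; apply/closed_unit_diskE; rewrite (normc_expi t).
Qed.

Lemma Rintegral_arclength_cst (c : R) : \int[arclength]_(_ in D) c = c.
Proof.
have mD := @measurable_closed_unit_disk R.
by rewrite Rintegral_cst// [X in fine X](_ : _ = 1%E) ?mulr1//; exact: arclength_disk.
Qed.

Lemma disk_continuous_comp f phi (K : R) :
  (forall z, normc z <= 1 -> normc (phi z) <= 1) ->
  (forall z w, normc z <= 1 -> normc w <= 1 ->
     normc (phi z - phi w) <= K * normc (z - w)) ->
  disk_continuous f -> disk_continuous (f \o phi).
Proof.
move=> phiD phiK /within_continuousP fc; apply/within_continuousP.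
move=> z /closed_unit_diskE z1 e e0.
have Dphi : D (phi z) by apply/closed_unit_diskE; exact: phiD.
have [d d0 dz] := fc (phi z) Dphi e e0.
have K0 : 0 < `|K| + 1 by have := normr_ge0 K; lra.
exists (d / (`|K| + 1)); first by rewrite divr_gt0.
move=> w /closed_unit_diskE w1; rewrite ltr_pdivlMr// => zw.
apply: dz; first by apply/closed_unit_diskE; exact: phiD.
apply: le_lt_trans (phiK _ _ z1 w1) _; apply: le_lt_trans zw.
rewrite mulrC ler_wpM2l ?normc_ge0//.
by have := ler_norm K; lra.
Qed.

(* A rotation or a power map sends the arc length to a measure with the same
   moments, hence to itself. *)
Lemma Rintegral_arclength_comp f phi (K : R) :
  (forall z, normc z <= 1 -> normc (phi z) <= 1) ->
  (forall z w, normc z <= 1 -> normc w <= 1 ->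
     normc (phi z - phi w) <= K * normc (z - w)) ->
  (forall a b, Cintegral arclength D (cmonom a b \o phi) = (a == b)%:R) ->
  disk_continuous f ->
  \int[arclength]_(z in D) f (phi z) = \int[arclength]_(z in D) f z.
Proof.
move=> phiD phiK mom fc.
have S1 : disk_state (fun g => \int[@arclength R]_(z in D) g z).
  by apply: disk_state_Rintegral; rewrite [leLHS](_ : _ = 1%E)//; exact: arclength_disk.
have S2 : disk_state (fun g => \int[@arclength R]_(z in D) g (phi z)).
  split=> [g h gc hc|c g gc|g e gc ge].
  - by apply: (disk_stateD S1); exact: (disk_continuous_comp phiD phiK).
  - by apply: (disk_stateZ S1); exact: (disk_continuous_comp phiD phiK).
  - apply: (disk_state_le S1); first exact: (disk_continuous_comp phiD phiK).
    by move=> z z1; apply: ge; exact: phiD.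
have cM : forall a b, Cintegral arclength D (cmonom a b \o phi) =
    Cintegral arclength D (cmonom a b).
  by move=> a b; rewrite mom Cintegral_arclength_cmonom.
(* For a constant family of functionals, convergence of moments is their equality, and uniqueness of
   limits turns convergence at f into equality at f. *)
have cf : \int[@arclength R]_(z in D) f (phi z) @[_ --> \oo] -->
    \int[@arclength R]_(z in D) f z.
  apply: (@disk_state_cvg R nat \oo _ (fun _ g => \int[@arclength R]_(z in D) g (phi z)))
    => // a b.
  have /eqP := cM a b; rewrite eq_complex /= => /andP[/eqP <- /eqP <-].
  by split; exact: cvg_cst.
rewrite -(cvg_lim (@Rhausdorff R) cf); apply/esym/cvg_lim; first exact: Rhausdorff.
exact: cvg_cst.
Qed.

(** The moment with exponents a, b is multiplied by (-1)^(a + b): this is 1 if a = b, and otherwise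
    the moment vanishes. *)
Lemma Rintegral_arclength_opp f : disk_continuous f ->
  \int[arclength]_(z in D) f (- z) = \int[arclength]_(z in D) f z.
Proof.
apply: (@Rintegral_arclength_comp _ _ 1).
- by move=> z; rewrite normcN.
- by move=> z w _ _; rewrite -opprD normcN mul1r.
move=> a b; have S1 : disk_state (fun g => \int[@arclength R]_(z in D) g z).
  by apply: disk_state_Rintegral; rewrite [leLHS](_ : _ = 1%E)//; exact: arclength_disk.
have [cR cI] := @continuous_cmonom R a b.
have E z : cmonom a b (- z) = ((-1) ^+ (a + b))%:C * cmonom a b z.
  rewrite /cmonom -[in LHS]mulN1r rmorphM rmorphN rmorph1 !exprMn mulrACA -exprD.
  by rewrite rmorphXn /= rmorphN1.
have := @Cintegral_arclength_cmonom R a b; rewrite /Cintegral.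
rewrite (_ : (\int[_]_(z in D) complex.Re ((cmonom a b \o -%R) z)) =
   (-1) ^+ (a + b) * \int[@arclength R]_(z in D) complex.Re (cmonom a b z)); last first.
  rewrite -(disk_stateZ S1); last exact: disk_continuous_within.
  by apply: eq_Rintegral => z _ /=; rewrite E; case: (cmonom a b z) => x y /=; rewrite mul0r subr0.
rewrite (_ : (\int[_]_(z in D) complex.Im ((cmonom a b \o -%R) z)) =
   (-1) ^+ (a + b) * \int[@arclength R]_(z in D) complex.Im (cmonom a b z)); last first.
  rewrite -(disk_stateZ S1); last exact: disk_continuous_within.
  by apply: eq_Rintegral => z _ /=; rewrite E; case: (cmonom a b z) => x y /=; rewrite mul0r addr0.
move=> /eqP; rewrite eq_complex /= => /andP[/eqP -> /eqP ->].
have [->|ab] := eqVneq a b; last by rewrite /= !mulr0.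
by rewrite addnn -mul2n exprM sqrrN expr1n expr1n /= mulr0 mulr1.
Qed.

Lemma Rintegral_arclength_sqr f : disk_continuous f ->
  \int[arclength]_(z in D) f (z ^+ 2) = \int[arclength]_(z in D) f z.
Proof.
apply: (@Rintegral_arclength_comp _ (fun z => z ^+ 2) 2).
- by move=> z z1; rewrite normcX exprn_ile1// normc_ge0.
- move=> z w z1 w1; rewrite subr_sqr normcM mulrC ler_wpM2r ?normc_ge0//.
  by have := ler_normcD z w; lra.
move=> a b; rewrite (_ : _ \o _ = cmonom (2 * a) (2 * b)).
  by rewrite Cintegral_arclength_cmonom eqn_mul2l.
by apply/funext => z; rewrite /cmonom /= rmorphXn !exprM.
Qed.

Lemma disk_continuous_ln f :
  (forall z, normc z <= 1 -> 0 < f z) -> disk_continuous f ->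
  disk_continuous (fun z => ln (f z)).
Proof.
move=> f0 /within_continuousP fc; apply/within_continuousP => z Dz e e0.
have fz0 : 0 < f z by apply: f0; apply/closed_unit_diskE.
have /cvgrPdist_lt /(_ e e0) := @continuous_ln R _ fz0.
rewrite near_simpl => /nbhs_ballP[r /= r0 rP].
have [d d0 dP] := fc z Dz r r0; exists d => // w Dw zw.
by apply: rP; rewrite -ball_normE /=; exact: dP.
Qed.

Lemma disk_continuous_normc_affine (a b : R[i]) :
  disk_continuous (fun w => normc (a - b * w)).
Proof.
apply: disk_continuous_within; apply: continuous_normcP => z e e0.
have K0 : 0 < normc b + 1 by have := normc_ge0 b; lra.
exists (e / (normc b + 1)); first by rewrite divr_gt0.
move=> w; rewrite ltr_pdivlMr// => zw.
apply: le_lt_trans (ler_normc_dist _ _) _; apply: le_lt_trans zw.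
rewrite (_ : a - b * z - (a - b * w) = - (b * (z - w))); last by ring.
by rewrite normcN normcM mulrC ler_wpM2l ?normc_ge0//; lra.
Qed.

Lemma normc1B_gt0 y w : normc y < 1 -> normc w <= 1 ->
  1 - normc y <= normc (1 - y * w).
Proof.
move=> y1 w1; have := ler_normc_dist 1 (y * w); rewrite normc1 ler_norml.
have : normc (y * w) <= normc y by rewrite normcM ler_piMr// normc_ge0.
by move=> ? /andP[_ ?]; lra.
Qed.

Lemma disk_continuous_ln1B y : normc y < 1 ->
  disk_continuous (fun w => ln (normc (1 - y * w))).
Proof.
move=> y1; apply: disk_continuous_ln => [w w1|]; last exact: disk_continuous_normc_affine.
by apply: lt_le_trans (normc1B_gt0 y1 w1); lra.
Qed.

(** The factorization 1 - y^2 w^2 = (1 - y w)(1 + y w), with w -> -w used on one factor and w -> w^2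
    on the product. *)
Lemma Rintegral_ln1B_double y : normc y < 1 ->
  2 * \int[arclength]_(w in D) ln (normc (1 - y * w)) =
  \int[arclength]_(w in D) ln (normc (1 - y ^+ 2 * w)).
Proof.
move=> y1; have S1 : disk_state (fun g => \int[@arclength R]_(z in D) g z).
  by apply: disk_state_Rintegral; rewrite [leLHS](_ : _ = 1%E)//; exact: arclength_disk.
have y2 : normc (y ^+ 2) < 1 by rewrite normcX exprn_ilt1// normc_ge0.
have yN : normc (- y) < 1 by rewrite normcN.
have lpos z w : normc z < 1 -> normc w <= 1 -> 0 < normc (1 - z * w).
  by move=> z1 w1; apply: lt_le_trans (normc1B_gt0 z1 w1); lra.
rewrite mulr_natl mulr2n -[X in X + _]Rintegral_arclength_opp; last exact: disk_continuous_ln1B.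
rewrite -[RHS](Rintegral_arclength_sqr (disk_continuous_ln1B y2)).
rewrite (_ : \int[_]_(z in D) ln (normc (1 - y * - z)) =
  \int[arclength]_(z in D) ln (normc (1 - (- y) * z))); last first.
  by apply: eq_Rintegral => z _; rewrite mulrN mulNr.
rewrite -(disk_stateD S1); [|exact: disk_continuous_ln1B..].
apply: eq_Rintegral => w /set_mem /closed_unit_diskE w1.
rewrite -lnM ?posrE; [|exact: lpos..].
by rewrite -normcM; congr (ln (normc _)); ring.
Qed.

(** A negative value would double under each squaring of y and tend to -oo, whereas ln (1 -
    |y|^(2^k)) >= ln (1 - |y|) bounds all iterates below. *)
Lemma Rintegral_ln1B_ge0 y : normc y < 1 ->
  0 <= \int[arclength]_(w in D) ln (normc (1 - y * w)).
Proof.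
move=> y1; set A := \int[_]_(_ in _) _; rewrite leNgt; apply/negP => A0.
have low z : normc z < 1 ->
    ln (1 - normc z) <= \int[arclength]_(w in D) ln (normc (1 - z * w)).
  move=> z1; rewrite -[leLHS]Rintegral_arclength_cst.
  have nu1 : (@arclength R D < +oo)%E by rewrite [ltLHS](_ : _ = 1%E) ?ltry//; exact: arclength_disk.
  apply: le_Rintegral.
  - exact: measurable_closed_unit_disk.
  - by apply: disk_integrable => //; exact: disk_continuous_cst.
  - by apply: disk_integrable => //; exact: disk_continuous_ln1B.
  - move=> w /closed_unit_diskE w1; rewrite ler_ln ?posrE ?subr_gt0//.
      exact: normc1B_gt0.
    by apply: lt_le_trans (normc1B_gt0 z1 w1); lra.
have yk k : normc (y ^+ (2 ^ k)) <= normc y.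
  by rewrite normcX ler_iXnr ?expn_gt0 ?normc_ge0// ltW.
have iter k : (2 ^ k)%:R * A = \int[arclength]_(w in D) ln (normc (1 - y ^+ (2 ^ k) * w)).
  elim: k => [|k IH]; first by rewrite expn0 mul1r.
  rewrite expnS natrM -mulrA IH Rintegral_ln1B_double; last exact: le_lt_trans (yk k) y1.
  by rewrite -exprM mulnC.
(* Division by the negative integral [A] turns the lower bound into 2^k <= ln (1 - |y|) / A, while k
   itself already exceeds this quotient. *)
pose k := (Num.truncn (ln (1 - normc y) / A)).+1.
have : ln (1 - normc y) <= (2 ^ k)%:R * A.
  rewrite iter; apply: le_trans (low _ (le_lt_trans (yk k) y1)).
  rewrite ler_ln ?posrE ?subr_gt0 ?(le_lt_trans (yk k) y1)//.
  by have := yk k; lra.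
apply/negP; rewrite -ltNge -ltr_ndivrMr//.
apply: lt_le_trans (truncnS_gt _) _.
by rewrite ler_nat -/k ltnW// ltn_expl.
Qed.

End log_potential.

(** * Logarithmic potential and energy of arc length *)

Section log_energy.
Context {R : realType}.
Implicit Types (y z w : R[i]) (K : set R[i]).

Local Notation D := (@closed_unit_disk R).
Local Notation U := (uniform_prob (@pi2_gt0 R)).

Lemma ge0_integral_arclength (f : R[i] -> \bar R) :
  measurable_fun setT f -> (forall z, (0 <= f z)%E) ->
  (\int[arclength]_w f w = \int[U]_t f (expi t))%E.
Proof.
move=> mf f0.
have := @ge0_integral_pushforward _ _ (g_sigma_algebraType R.-ocitv.-measurable)
  _ _ _ (@measurable_expi R) U setT _ measurableT mf (fun z _ => f0 z).
by rewrite preimage_setT => H; exact: H.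
Qed.

Lemma integral_arclength (f : R[i] -> \bar R) : measurable_fun setT f ->
  (\int[arclength]_w f w = \int[U]_t f (expi t))%E.
Proof.
move=> mf; rewrite [LHS]integralE [RHS]integralE.
rewrite !ge0_integral_arclength//.
- by congr (_ - _)%E; apply: eq_integral => t _; rewrite ?funeposE ?funenegE.
- exact: measurable_funeneg.
- exact: measurable_funepos.
Qed.

(** The shift e keeps the logarithm finite, and ln |1 - y w| lies below the integrand for a suitable
    |y| < 1. If |z| > 1, take y = 1 / z, since |z - w| = |z| |1 - w / z|. If |z| <= 1, take y = conj
    u with u = z / (1 + e), since |1 - y w| = |w - u| on the circle and |z - u| <= e. *)
Lemma Rintegral_uniform_ln_dist_ge0 z (e : R) : 0 < e ->
  U.-integrable setT (fun t => (ln (normc (z - expi t) + e))%:E) /\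
  0 <= \int[U]_t ln (normc (z - expi t) + e).
Proof.
move=> e0; have dc : disk_continuous (fun w => ln (normc (z - w) + e)).
  apply: disk_continuous_ln => [w _|]; first by have := normc_ge0 (z - w); lra.
  apply: disk_continuousD; last exact: disk_continuous_cst.
  have := @disk_continuous_normc_affine R z 1.
  by rewrite (_ : (fun w => normc (z - 1 * w)) = fun w => normc (z - w))//;
    apply/funext => w; rewrite mul1r.
have intd := integrable_expi dc; split; first exact: intd.
have main y : normc y < 1 ->
    (forall t, normc (1 - y * expi t) <= normc (z - expi t) + e) ->
    0 <= \int[U]_t ln (normc (z - expi t) + e).
  move=> y1 H; apply: le_trans (Rintegral_ln1B_ge0 y1) _.
  rewrite Rintegral_arclength; last exact: disk_continuous_ln1B.
  apply: le_Rintegral => //; first exact: integrable_expi (disk_continuous_ln1B y1).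
  move=> t _; rewrite ler_ln ?posrE//.
    apply: lt_le_trans (normc1B_gt0 y1 _); [lra|by rewrite normc_expi].
  by have := normc_ge0 (z - expi t); lra.
have [z1|z1] := leP (normc z) 1.
  pose u := (1 + e)^-1%:C * z.
  have uz : normc u = normc z / (1 + e).
    by rewrite normcM normc_real ger0_norm ?invr_ge0; [rewrite mulrC|lra].
  apply: (main (u^*)%C) => [|t].
    by rewrite normc_conjc uz ltr_pdivrMr; lra.
  have -> : 1 - (u^*)%C * expi t = expi t * ((expi t - u)^*)%C.
    have -> : ((expi t - u)^* = expi (- t) - u^*)%C by rewrite -conjc_expi; exact: rmorphB.
    by rewrite mulrBr -expiD subrr expi0 [in RHS]mulrC.
  rewrite normcM normc_expi mul1r normc_conjc normc_distC.
  apply: le_trans (ler_normc_distD z _ _) _; rewrite lerD2l.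
  rewrite (_ : z - u = (1 - (1 + e)^-1)%:C * z); last first.
    by rewrite /u rmorphB /= mulrBl mul1r.
  rewrite normcM normc_real.
  have -> : 1 - (1 + e)^-1 = e / (1 + e) by field; lra.
  rewrite ger0_norm; last by rewrite divr_ge0; lra.
  have : e / (1 + e) <= e by rewrite ler_pdivrMr; nra.
  have : 0 <= e / (1 + e) by rewrite divr_ge0; lra.
  have := normc_ge0 z; move: (_ / _) => q; nra.
have z0 : z != 0 by apply/eqP => z0; rewrite z0 normc0 in z1; lra.
have nz0 : 0 < normc z by apply: lt_trans z1.
apply: (main z^-1) => [|t]; first by rewrite normcV invf_lt1.
apply: (@le_trans _ _ (normc (z - expi t))); last by rewrite lerDl ltW.
have -> : z - expi t = z * (1 - z^-1 * expi t) by rewrite mulrBr mulr1 mulVKf.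
by rewrite normcM ler_peMl ?normc_ge0// ltW.
Qed.

(* As [n] grows, [reg z n w] increases to [ln (|z| + 2) - ln |z - w|], and it is
   nonnegative when [|w| = 1]. *)
Let reg z n w : \bar R := (ln (normc z + 2) - ln (normc (z - w) + n.+1%:R^-1))%:E.

Let reg_cvg z w :
  reg z n w @[n --> \oo] --> ((ln (normc z + 2))%:E - lne (normc (z - w))%:E)%E.
Proof.
rewrite /reg; have := normc_ge0 (z - w); rewrite le_eqVlt => /predU1P[<-|x0].
  rewrite le0_lneNy//= addey//.
  apply/cvgeryP; apply/cvgryPge => A.
  have := nbhs_infty_ger (expR (A - ln (normc z + 2))); apply: filterS => n nA.
  rewrite add0r lnV ?posrE// opprK -lerBlDl.
  rewrite -[leLHS]expRK ler_ln ?posrE ?expR_gt0//.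
  by apply: le_trans nA _; rewrite ler_nat.
rewrite lne_EFin// -EFinB; apply: cvg_EFin; first exact: nearW.
apply: cvgB; first exact: cvg_cst.
have xn : normc (z - w) + n.+1%:R^-1 @[n --> \oo] --> normc (z - w).
  by rewrite -[X in _ --> X]addr0; apply: cvgD; [exact: cvg_cst|exact: cvg_harmonic].
exact: (cvg_comp _ _ xn (continuous_ln x0)).
Qed.

Let measurable_reg z n : measurable_fun setT (reg z n).
Proof.
apply/measurable_EFinP; apply: measurable_funB => //.
apply: (measurableT_comp (@measurable_ln R)).
apply: measurable_funD => //; apply: continuous_measurable_funC.
apply: continuous_normcP => w e e0; exists e => // w' ww'.
apply: le_lt_trans (ler_normc_dist _ _) _.
by rewrite opprB addrC addrA subrK normc_distC.
Qed.

(** Adding M makes the kernel nonnegative on the circle, so monotone convergence along [reg]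
    applies; each regularized integral is at most M by [Rintegral_uniform_ln_dist_ge0], and M is
    subtracted again. *)
Lemma log_potential_le0 z : (\int[arclength]_w - lne (normc (z - w))%:E <= 0)%E.
Proof.
set M := ln (normc z + 2); pose H w := (M%:E - lne (normc (z - w))%:E)%E.
have mH : measurable_fun setT H.
  apply: (emeasurable_fun_cvg (reg z)); first exact: measurable_reg.
  by move=> w _; exact: reg_cvg.
have fE w : (- lne (normc (z - w))%:E)%E = (H w - M%:E)%E.
  by rewrite /H addeAC subee// add0e.
under eq_integral do rewrite fE.
rewrite integral_arclength; last exact: emeasurable_funB.
have mHe : measurable_fun setT (fun t => H (expi t)).
  by apply: measurableT_comp => //; exact: measurable_expi.
have dpos n w : 0 < normc (z - w) + n.+1%:R^-1.
  by rewrite ltr_wpDl ?normc_ge0.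
(* On the circle |z - w| + 1 / (n + 1) <= |z| + 2, which is where the constant 2 in [reg] comes
   from. *)
have reg0 n t : (0 <= reg z n (expi t))%E.
  rewrite lee_fin subr_ge0 ler_ln ?posrE.
  - have := ler_normcD z (- expi t); rewrite normcN normc_expi.
    have : (n.+1%:R^-1 : R) <= 1 by rewrite invf_le1// ler1n.
    by move: (n.+1%:R^-1) (normc (z - _)) (normc z) => a b c; lra.
  - exact: dpos.
  - by have := normc_ge0 z; lra.
have H0 t : (0 <= H (expi t))%E.
  rewrite (_ : H (expi t) = limn (fun n => reg z n (expi t))); last first.
    by apply/esym/cvg_lim => //; exact: reg_cvg.
  apply: lime_ge; first by apply/cvg_ex; eexists; exact: reg_cvg.
  exact: nearW.
have intH : (\int[U]_t H (expi t) <= M%:E)%E.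
  rewrite (_ : \int[U]_t H (expi t) = \int[U]_t limn (fun n => reg z n (expi t)))%E; last first.
    by apply: eq_integral => t _; apply/esym/cvg_lim => //; exact: reg_cvg.
  rewrite monotone_convergence//; last 2 first.
  - by move=> n; apply: measurableT_comp; [exact: measurable_reg|exact: measurable_expi].
  - move=> t _ m n mn; rewrite lee_fin lerD2l lerN2 ler_ln ?posrE.
    + by rewrite lerD2l lef_pV2 ?posrE// ler_nat.
    + exact: dpos.
    + exact: dpos.
  apply: lime_le.
    apply: ereal_nondecreasing_is_cvgn => m n mn; apply: ge0_le_integral => //.
    - by apply: measurableT_comp; [exact: measurable_reg|exact: measurable_expi].
    - by apply: measurableT_comp; [exact: measurable_reg|exact: measurable_expi].
    - move=> t _; rewrite lee_fin lerD2l lerN2 ler_ln ?posrE.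
      + by rewrite lerD2l lef_pV2 ?posrE// ler_nat.
      + exact: dpos.
      + exact: dpos.
  apply: nearW => n.
  have n0 : 0 < (n.+1%:R^-1 : R) by [].
  have [int1 int2] := Rintegral_uniform_ln_dist_ge0 z n0.
  have cM := integrable_expi (@disk_continuous_cst R M).
  have intR : U.-integrable setT (fun t => reg z n (expi t)).
    exact: (integrableB measurableT cM int1).
  rewrite -[leLHS]fineK; last exact: integrable_fin_num.
  rewrite lee_fin; have := RintegralB measurableT cM int1.
  by rewrite Rintegral_uniform_cst /Rintegral /reg => ->; rewrite gerBl.
have iH : U.-integrable setT (fun t => H (expi t)).
  apply/integrableP; split => //.
  under eq_integral do rewrite gee0_abs//.
  by apply: le_lt_trans intH _; rewrite ltry.
have cM := integrable_expi (@disk_continuous_cst R M).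
rewrite integralB// (_ : \int[U]_t M%:E = M%:E)%E; last first.
  rewrite -[RHS](_ : (\int[U]_t M)%:E = _)%E; last by rewrite Rintegral_uniform_cst.
  by rewrite fineK//; exact: integrable_fin_num.
by rewrite leeBlDr// add0e.
Qed.

Lemma log_energy_arclength_le0 : (log_energy (@arclength R) <= 0)%E.
Proof.
pose P z := (- \int[arclength]_w - lne (normc (z - w))%:E)%E.
have P0 z : (0 <= P z)%E by rewrite oppe_ge0; exact: log_potential_le0.
rewrite /log_energy (_ : integral _ _ _ = (\int[@arclength R]_z - P z)%E); last first.
  by apply: eq_integral => z _; rewrite oppeK.
by rewrite integral_ge0N// oppe_le0; exact: integral_ge0.
Qed.

Lemma capacity_ge1 K : unit_circle `<=` K -> (1 <= capacity K)%E.
Proof.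
move=> circK; rewrite /capacity -[leLHS]expeR0 lee_expeR oppe_ge0.
have arcK : arclength K = 1%E.
  rewrite /arclength /pushforward (_ : _ @^-1` _ = setT); first exact: probability_setT.
  by apply/seteqP; split=> // t _; apply: circK; apply/unit_circleE; rewrite normc_expi.
apply: le_trans log_energy_arclength_le0; apply: ereal_inf_lbound.
by exists [the probability R[i] R of @arclength R].
Qed.

End log_energy.

(** * Sequences of slow growth *)

Section slow_growth.
Context {R : realType}.
Variable L : nat -> R.
Hypothesis L_nd : forall n, L n <= L n.+1.
Hypothesis L_slow : forall e : R, 0 < e -> \forall n \near \oo, L n <= e * n%:R.

Let L_mono m n : (m <= n)%N -> L m <= L n.
Proof.
by move=> /subnK <-; elim: (n - m)%N => // k IH; apply: le_trans IH _; rewrite addSn.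
Qed.

(** One index sets both the step k + 1 and the tolerance 1 / (k + 1), so that escaping [jump k] for
    large k makes every fixed increment small. *)
Let jump k n : bool := k.+1%:R^-1 < L (n + k.+1) - L n.

Let jumpW k l n : (k <= l)%N -> jump k n -> jump l n.
Proof.
rewrite /jump => kl H; apply: (@le_lt_trans _ _ (k.+1%:R^-1)).
  by rewrite lef_pV2 ?posrE// ler_nat.
by apply: lt_le_trans H _; rewrite lerD2r L_mono// leq_add2l.
Qed.

Let count_jump k M := (\sum_(1 <= n < M.+1) jump k n)%N.

(** Splitting an increment of length m into unit ones gives m telescoping sums, each at most L (M +
    m) - L 0 by monotonicity. *)
Let sum_increments m M :
  \sum_(1 <= n < M.+1) (L (n + m) - L n) <= m%:R * (L (M + m) - L 0).
Proof.
elim: m => [|m IH].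
  by rewrite mul0r big1// => n _; rewrite addn0 subrr.
have -> : \sum_(1 <= n < M.+1) (L (n + m.+1) - L n) =
    \sum_(1 <= n < M.+1) (L (n + m) - L n) +
    \sum_(1 <= n < M.+1) (L (n.+1 + m) - L (n + m)).
  by rewrite -big_split /=; apply: eq_bigr => n _; rewrite addSnnS; ring.
rewrite (@telescope_sumr _ _ _ (fun n => L (n + m))) //.
apply: le_trans (lerD IH (lexx _)) _.
have H1 : L (M + m) <= L (M + m.+1) by rewrite L_mono// leq_add2l.
have H2 : L 0 <= L (1 + m) by rewrite L_mono.
rewrite addSnnS -natr1 mulrDl mul1r lerD//; last by rewrite lerD2l lerN2.
by rewrite ler_wpM2l// lerD2r.
Qed.

(** Markov's inequality: each jump contributes more than 1 / (k + 1) to a sum of nonnegative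
    increments. *)
Let count_jump_le k M :
  (count_jump k M)%:R <= k.+1%:R ^+ 2 * (L (M + k.+1) - L 0).
Proof.
rewrite /count_jump natr_sum expr2 -mulrA.
apply: le_trans (ler_wpM2l _ (sum_increments k.+1 M)) => //.
rewrite mulr_sumr; apply: ler_sum => n _.
case: (boolP (jump k n)) => [|_] /=.
  by rewrite /jump => /ltW; rewrite -[leLHS]mulr1 ler_pdivrMl.
by rewrite mulr_ge0// subr_ge0 L_mono// leq_addr.
Qed.

Let jump_rare k : \forall M \near \oo, (count_jump k M * k.+1 <= M)%N.
Proof.
set K : R := k.+1%:R; have K0 : 0 < K by rewrite ltr0n.
have K3 : 0 < K ^+ 3 by rewrite exprn_gt0.
(* With this slope, K times the count is at most (M + K) / 2 - K^3 L 0, which is at most M once M >=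
   K - 2 K^3 L 0. *)
have e0 : 0 < (2 * K ^+ 3)^-1 by rewrite invr_gt0 mulr_gt0.
have [n0 _ n0P] := L_slow e0.
have [n1 _ n1P] := nbhs_infty_ger (K - 2 * K ^+ 3 * L 0).
exists (maxn n0 n1) => // M; rewrite /= geq_max => /andP[n0M n1M].
rewrite -(ler_nat R) natrM.
have := n0P (M + k.+1)%N (leq_trans n0M (leq_addr _ _)).
rewrite natrD -/K; have := n1P M n1M => /=.
have := count_jump_le k M; rewrite -/K.
move: (count_jump k M)%:R (L (M + k.+1)) (L 0) (M%:R : R) => c l l0 m H1 H2 H3.
have : c * K <= K ^+ 3 * (l - l0).
  by rewrite exprSr [K ^+ 2 * K]mulrC -mulrA mulrC ler_wpM2l// ltW.
move=> /le_trans; apply.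
have : K ^+ 3 * l <= (m + K) / 2.
  rewrite -(ler_pM2l K3) in H3; apply: le_trans H3 _.
  by rewrite le_eqVlt; apply/orP; left; apply/eqP; field; rewrite gt_eqF.
by rewrite mulrBr; lra.
Qed.

Let calm k M := forall M', (M <= M')%N -> (count_jump k M' * k.+1 <= M')%N.

(* The sets [jump k] increase with [k] and have density 0.  As [level n] tends
   to infinity slowly enough, the diagonal set of all [n] with
   [jump (level n) n] has density 0 too, and contains each [jump k] up to
   finitely many elements. *)
Let level M : nat := (\max_(k < M.+1 | `[< calm k M >]) k)%N.

Let level_calm M : calm (level M) M.
Proof.
have calm0 : calm 0 M.
  move=> M' _; rewrite muln1 /count_jump.
  apply: (@leq_trans (\sum_(1 <= n < M'.+1) 1)).
    by apply: leq_sum => n _; exact: leq_b1.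
  by rewrite sum_nat_const_nat muln1 subSS subn0.
have [|k kA kE] := @eq_bigmax_cond 'I_M.+1
    [pred k : 'I_M.+1 | `[< calm k M >]] (fun k => k : nat).
  by apply/card_gt0P; exists ord0; apply/asboolP; exact: calm0.
by rewrite /level kE; exact/asboolP.
Qed.

Let level_ge k M : (k <= M)%N -> calm k M -> (k <= level M)%N.
Proof.
rewrite -ltnS => kM ckM; rewrite /level.
exact: (@leq_bigmax_cond 'I_M.+1 (fun k => `[< calm k M >]) (fun k => k : nat)
  (Ordinal kM) (asboolT ckM)).
Qed.

Let levelW M M' : (M <= M')%N -> (level M <= level M')%N.
Proof.
move=> MM'; apply: level_ge; last first.
  by move=> M'' M'M''; apply: level_calm; exact: leq_trans M'M''.
by apply/bigmax_leqP => k _; rewrite -ltnS (leq_trans (ltn_ord k)).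
Qed.

Let level_infty k : \forall M \near \oo, (k <= level M)%N.
Proof.
have [n0 _ n0P] := jump_rare k; exists (maxn n0 k) => // M.
rewrite /= geq_max => /andP[n0M kM]; apply: level_ge => // M' MM'.
by apply: n0P; exact: leq_trans MM'.
Qed.

Lemma slow_growth_density1 : exists N : set nat,
  asymptotic_density1 (R := R) N /\
  forall a (e : R), 0 < e -> \forall n \near \oo, N n -> L (n + a) - L n <= e.
Proof.
exists [set n | ~~ jump (level n) n]; split; last first.
  move=> a e e0.
  have [n0 _ n0P] := nbhs_infty_ger (e^-1).
  (* A level of at least [a] makes the controlled step longer than [a]; a level of at least [n0]
     makes its tolerance at most e. *)
  have [n1 _ n1P] := level_infty (maxn n0 a).
  exists n1 => // n n1n /=; have := n1P n n1n => /=; rewrite geq_max => /andP[n0l al].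
  rewrite /jump -leNgt => H; apply: (@le_trans _ _ (L (n + (level n).+1) - L n)).
    by rewrite lerD2r L_mono// leq_add2l (leq_trans al).
  apply: le_trans H _; rewrite invf_ple ?posrE//.
  by apply: le_trans (n0P n0 (leqnn _)) _; rewrite ler_nat (leq_trans n0l).
rewrite /asymptotic_density1; apply/cvgrPdist_le => e e0.
have [n0 _ n0P] := nbhs_infty_ger (e^-1).
have [n1 _ n1P] := level_infty n0.
exists n1.+1 => // M /= n1M.
have M0 : (0 < M)%N by apply: leq_trans n1M.
have M0' : (0 : R) < M%:R by rewrite ltr0n.
set l := level M; have n0l : (n0 <= l)%N by apply: n1P; exact: ltnW.
set S := (\sum_(1 <= k < M.+1) _)%N.
have SE : (S + \sum_(1 <= n < M.+1) jump (level n) n = M)%N.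
  transitivity (\sum_(1 <= n < M.+1) 1)%N; last first.
    by rewrite sum_nat_const_nat muln1 subSS subn0.
  rewrite -big_split /=.
  apply: eq_bigr => n _; rewrite (_ : (n \in _) = ~~ jump (level n) n); first by case: jump.
  by apply/idP/idP => [/set_mem|/mem_set].
(* For n <= M the level of n is at most that of M, so all exceptional n up to M are jumps for the
   one index [level M], whose count is bounded by calmness at M. *)
have bad : ((\sum_(1 <= n < M.+1) jump (level n) n) * l.+1 <= M)%N.
  apply: leq_trans (@level_calm M M (leqnn M)); rewrite leq_mul2r; apply/orP; right.
  rewrite /count_jump big_nat [leqRHS]big_nat; apply: leq_sum => n /andP[_ nM].
  case: (boolP (jump (level n) n)) => // /(jumpW (levelW _)) -> //.
move: bad SE; set B := (\sum_(1 <= n < M.+1) _)%N => bad SE.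
have -> : 1 - S%:R / M%:R = B%:R / M%:R :> R.
  have ME : M%:R = S%:R + B%:R :> R by rewrite -natrD SE.
  by rewrite ME; field; rewrite -ME gt_eqF.
rewrite ger0_norm; last by rewrite divr_ge0.
rewrite ler_pdivrMr//; have : (B%:R * l.+1%:R <= M%:R :> R) by rewrite -natrM ler_nat.
have : e^-1 <= l.+1%:R.
  by apply: le_trans (n0P n0 (leqnn _)) _; rewrite ler_nat (leq_trans n0l).
rewrite -[e^-1]mul1r ler_pdivrMr// => el Bl.
have : B%:R * 1 <= B%:R * (l.+1%:R * e) by rewrite ler_wpM2l.
rewrite mulr1 => /le_trans; apply.
by rewrite mulrA [leRHS]mulrC ler_wpM2r// ltW.
Qed.

End slow_growth.

(** * Orthonormal polynomials *)

Section null_complement.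
Context {R : realType}.
Implicit Types (mu : {measure set R[i] -> \bar R}).

Local Notation D := (@closed_unit_disk R).

Let rdisk (q : rat * rat * nat) : set R[i] :=
  [set w | normc ((ratr q.1.1 +i* ratr q.1.2) - w) < q.2.+1%:R^-1].

Let open_rdisk q : open (rdisk q).
Proof.
rewrite openE => w /= wq; apply/nbhs_normcP.
exists (q.2.+1%:R^-1 - normc ((ratr q.1.1 +i* ratr q.1.2) - w)).
  by rewrite subr_gt0.
move=> v wv; rewrite /rdisk /=.
have := ler_normc_distD w (ratr q.1.1 +i* ratr q.1.2) v.
by move=> /le_lt_trans; apply; rewrite -ltrBrDl.
Qed.

Let rdisk_basis (U : set R[i]) z : open U -> U z ->
  exists2 q, rdisk q z & rdisk q `<=` U.
Proof.
rewrite openE => oU Uz; have /nbhs_normcP[e e0 eU] := oU z Uz.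
have [n ne] : exists n, n.+1%:R^-1 < e / 2.
  exists (Num.truncn (2 / e)).
  by rewrite invf_plt ?posrE ?divr_gt0// invf_div; exact: truncnS_gt.
pose r : R := n.+1%:R^-1; have r0 : 0 < r by rewrite invr_gt0.
have r20 : 0 < r / 2 by rewrite divr_gt0.
have [a] : exists a : rat, `|ratr a - complex.Re z| < r / 2.
  have [|a /itvP aI] := @rat_in_itvoo R (complex.Re z - r / 2) (complex.Re z + r / 2); first lra.
  by exists a; rewrite ltr_distl; apply/andP; rewrite !aI.
have [b] : exists b : rat, `|ratr b - complex.Im z| < r / 2.
  have [|b /itvP bI] := @rat_in_itvoo R (complex.Im z - r / 2) (complex.Im z + r / 2); first lra.
  by exists b; rewrite ltr_distl; apply/andP; rewrite !bI.
move=> bz az.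
have H : rdisk (a, b, n) z.
  rewrite /rdisk; case: z bz az {Uz eU} => x y bz az.
  apply: le_lt_trans (normc_le_ReIm ((ratr a +i* ratr b) - (x +i* y))) _.
  by rewrite /= -/r [ltRHS]splitr ltrD.
exists (a, b, n) => // w; move: H; rewrite /rdisk /= => H1 H2; apply: eU.
have := ler_normc_distD (ratr a +i* ratr b) z w; rewrite (normc_distC z (_ +i* _)).
by move=> /le_lt_trans; apply; rewrite [ltRHS]splitr; apply: ltrD; [exact: lt_trans H1 ne|exact: lt_trans H2 ne].
Qed.

(** The plane has a countable base of rational disks. A point off the support lies in a null open
    set, hence in a null disk of the base, and these are countably many. *)
Lemma negligible_setC_support mu : mu.-negligible (~` Defs.support mu).
Proof.
(* Numbers coding no disk, and disks of positive mass, contribute the empty set. *)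
pose F (n : nat) : set R[i] := if unpickle n is Some q then
  (if mu (rdisk q) == 0%E then rdisk q else set0) else set0.
have mF n : measurable (F n).
  rewrite /F; case: unpickle => // q; case: ifPn => // _.
  exact: sub_sigma_algebra.
have F0 n : mu (F n) = 0%E.
  rewrite /F; case: unpickle => [q|]; last exact: measure0.
  by case: ifPn => [/eqP//|_]; exact: measure0.
apply: (@negligibleS _ _ _ mu (\bigcup_n F n)); last first.
by apply: negligible_bigcup => n; exists (F n); split; [exact: mF|exact: F0|].
move=> z /= nsz; have [U [oU Uz U0]] : exists U, [/\ open U, U z & mu U = 0%E].
  apply: contrapT => nU; apply: nsz => U oU Uz.
  rewrite lt0e measure_ge0 andbT; apply/eqP => U0; apply: nU; exists U; split => //.
have [q qz qU] := rdisk_basis oU Uz.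
have q0 : mu (rdisk q) == 0%E.
  rewrite eq_le measure_ge0 andbT -U0 le_measure ?inE//.
  - exact: sub_sigma_algebra.
  - exact: sub_sigma_algebra.
have Fz : F (pickle q) z by rewrite /F pickleK q0.
exact: (ex_intro2 _ _ (pickle q) I Fz).
Qed.

End null_complement.

(** * Inner products and shifts of orthonormal polynomials *)

Section orthonormal.
Context {R : realType}.
Variable mu : {finite_measure set R[i] -> \bar R}.
Implicit Types (p q : {poly R[i]}) (f g : R[i] -> R) (c : R[i]).

Local Notation D := (@closed_unit_disk R).
Local Notation J f := (\int[mu]_(z in D) f z).

Let muDy : (mu D < +oo)%E.
Proof. by rewrite -ge0_fin_numE// fin_num_measure//; exact: measurable_closed_unit_disk. Qed.

Lemma disk_RintegralD f g : disk_continuous f -> disk_continuous g ->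
  J (fun z => f z + g z) = J f + J g.
Proof.
move=> fc gc; rewrite RintegralD//; first exact: measurable_closed_unit_disk.
- exact: disk_integrable.
- exact: disk_integrable.
Qed.

Lemma disk_RintegralZ (x : R) f : disk_continuous f ->
  J (fun z => x * f z) = x * J f.
Proof.
move=> fc; rewrite RintegralZl//; first exact: measurable_closed_unit_disk.
exact: disk_integrable.
Qed.

Lemma disk_Rintegral_lin (x y : R) f g : disk_continuous f -> disk_continuous g ->
  J (fun z => x * f z + y * g z) = x * J f + y * J g.
Proof.
move=> fc gc; rewrite disk_RintegralD ?disk_RintegralZ//;
  by apply: disk_continuousM => //; exact: disk_continuous_cst.
Qed.

Lemma le_disk_Rintegral f g : disk_continuous f -> disk_continuous g ->
  (forall z, normc z <= 1 -> f z <= g z) -> J f <= J g.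
Proof.
move=> fc gc fg; apply: le_Rintegral; first exact: measurable_closed_unit_disk.
- exact: disk_integrable.
- exact: disk_integrable.
- by move=> z /closed_unit_diskE; exact: fg.
Qed.

Let hprod p q z : R[i] := (p.[z])^*%C * q.[z].

Let continuous_hprodRe p q : continuous (fun z => complex.Re (hprod p q z)).
Proof.
have cRe r : continuous (fun z : R[i] => complex.Re r.[z]).
  by move=> z; apply: continuous_comp; [exact: continuous_hornerC|exact: continuous_Re].
have cIm r : continuous (fun z : R[i] => complex.Im r.[z]).
  by move=> z; apply: continuous_comp; [exact: continuous_hornerC|exact: continuous_Im].
rewrite (_ : (fun z => _) = fun z => complex.Re p.[z] * complex.Re q.[z] +
   complex.Im p.[z] * complex.Im q.[z]).
  by apply: continuousD_real; exact: continuousM_real.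
by apply/funext => z; rewrite /hprod; case: p.[z] q.[z] => [x y] [x' y'] /=; ring.
Qed.

Let continuous_hprodIm p q : continuous (fun z => complex.Im (hprod p q z)).
Proof.
rewrite (_ : (fun z => _) = fun z => complex.Re (hprod p (- 'i%C *: q) z)).
  exact: continuous_hprodRe.
apply/funext => z; rewrite /hprod hornerZ.
by case: p.[z] q.[z] => [x y] [x' y'] /=; ring.
Qed.

Let hprodRe p q : disk_continuous (fun z => complex.Re (hprod p q z)).
Proof. exact/disk_continuous_within/continuous_hprodRe. Qed.

Let hprodIm p q : disk_continuous (fun z => complex.Im (hprod p q z)).
Proof. exact/disk_continuous_within/continuous_hprodIm. Qed.

(** Conjugate-linear in the first argument, as in [orthonormal_polys]. Integration is over the disk,
    where polynomials are bounded; [ipP] reconciles this with integrals over the plane. *)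
Definition poly_ip p q : R[i] := Cintegral mu D (hprod p q).

Definition poly_norm2 p : R := J (fun z => normc p.[z] ^+ 2).

Lemma poly_ipDr p q r : poly_ip p (q + r) = poly_ip p q + poly_ip p r.
Proof.
apply/eqP; rewrite eq_complex /=; apply/andP; split; apply/eqP.
- rewrite -disk_RintegralD//; apply: eq_Rintegral => z _.
  by rewrite /hprod hornerD mulrDr; case: (_ * _) (_ * _) => [x y] [x' y'].
- rewrite -disk_RintegralD//; apply: eq_Rintegral => z _.
  by rewrite /hprod hornerD mulrDr; case: (_ * _) (_ * _) => [x y] [x' y'].
Qed.

Lemma poly_ipZr c p q : poly_ip p (c *: q) = c * poly_ip p q.
Proof.
case: c => a b; apply/eqP; rewrite eq_complex /=; apply/andP; split; apply/eqP.
- rewrite -[X in _ = X - _]disk_RintegralZ// -mulNr -disk_RintegralZ// -disk_RintegralD.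
  + apply: eq_Rintegral => z _; rewrite /hprod hornerZ mulrCA.
    by case: (_ * q.[z]) => x y /=; rewrite mulNr.
  + by apply: disk_continuousM => //; exact: disk_continuous_cst.
  + by apply: disk_continuousM => //; exact: disk_continuous_cst.
- rewrite -!disk_RintegralZ// -disk_RintegralD.
  + apply: eq_Rintegral => z _; rewrite /hprod hornerZ mulrCA.
    by case: (_ * q.[z]) => x y /=.
  + by apply: disk_continuousM => //; exact: disk_continuous_cst.
  + by apply: disk_continuousM => //; exact: disk_continuous_cst.
Qed.

Lemma poly_ip_conj p q : (poly_ip p q)^*%C = poly_ip q p.
Proof.
apply/eqP; rewrite eq_complex /=; apply/andP; split; apply/eqP.
- apply: eq_Rintegral => z _; rewrite /hprod.
  by case: p.[z] q.[z] => [x y] [x' y'] /=; ring.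
- rewrite -mulN1r -disk_RintegralZ//; apply: eq_Rintegral => z _; rewrite /hprod.
  by case: p.[z] q.[z] => [x y] [x' y'] /=; ring.
Qed.

Lemma poly_ipDl p q r : poly_ip (p + q) r = poly_ip p r + poly_ip q r.
Proof.
rewrite -[LHS]poly_ip_conj poly_ipDr -(poly_ip_conj r p) -(poly_ip_conj r q).
exact: rmorphD.
Qed.

Lemma poly_ipZl c p q : poly_ip (c *: p) q = c^*%C * poly_ip p q.
Proof.
rewrite -[LHS]poly_ip_conj poly_ipZr -(poly_ip_conj q p).
exact: rmorphM.
Qed.

Lemma poly_ip0r p : poly_ip p 0 = 0.
Proof. by rewrite -(scale0r 0) poly_ipZr mul0r. Qed.

Lemma poly_ip_diag p : poly_ip p p = (poly_norm2 p)%:C.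
Proof.
apply/eqP; rewrite eq_complex /=; apply/andP; split; apply/eqP.
- apply: eq_Rintegral => z _; rewrite normc_sqr /hprod.
  by case: p.[z] => x y /=; ring.
- transitivity (J (fun z => 0 * complex.Re (hprod p p z))); last first.
    by rewrite disk_RintegralZ// mul0r.
  apply: eq_Rintegral => z _; rewrite /hprod.
  by case: p.[z] => x y /=; ring.
Qed.

Lemma poly_norm2_ge0 p : 0 <= poly_norm2 p.
Proof. by apply: Rintegral_ge0 => z _; rewrite sqr_ge0. Qed.

Lemma disk_continuous_normc_horner p : disk_continuous (fun z => normc p.[z] ^+ 2).
Proof.
rewrite (_ : (fun z => _) = fun z => complex.Re (hprod p p z)); first exact: hprodRe.
by apply/funext => z; rewrite normc_sqr /hprod; case: p.[z] => x y /=; ring.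
Qed.

Lemma poly_norm2XM a p : poly_norm2 ('X^a * p) <= poly_norm2 p.
Proof.
apply: le_disk_Rintegral; [exact: disk_continuous_normc_horner..|] => z z1.
rewrite hornerM hornerXn normcM exprMn ler_piMl ?sqr_ge0//.
by rewrite normcX -exprM exprn_ile1// normc_ge0.
Qed.

(** Cauchy-Schwarz, by integrating |p| |q| <= (s / 2) |p|^2 + |q|^2 / (2 s); the weight s balances
    the two norm bounds, each term contributing at most s / 2. *)
Lemma normr_poly_ip_le p q (s : R) : 0 < s ->
  poly_norm2 p <= 1 -> poly_norm2 q <= s ^+ 2 ->
  `|complex.Re (poly_ip p q)| <= s /\ `|complex.Im (poly_ip p q)| <= s.
Proof.
move=> s0 p1 qs.
have normpc := @disk_continuous_normc_horner p.
have normqc := @disk_continuous_normc_horner q.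
have bound f : disk_continuous f -> (forall z, `|f z| <= normc p.[z] * normc q.[z]) ->
    `|J f| <= s.
  move=> fc fpq; apply: le_trans (le_normr_Rintegral _ _) _.
  - exact: measurable_closed_unit_disk.
  - exact: disk_integrable.
  apply: (@le_trans _ _ (J (fun z => s / 2 * normc p.[z] ^+ 2 + (2 * s)^-1 * normc q.[z] ^+ 2))).
    apply: le_disk_Rintegral.
    - move=> z; apply: continuous_comp; first exact: fc.
      exact: norm_continuous.
    - by apply: disk_continuousD; apply: disk_continuousM => //; exact: disk_continuous_cst.
    - move=> z _; apply: le_trans (fpq z) _.
      rewrite -subr_ge0.
      have -> : s / 2 * normc p.[z] ^+ 2 + (2 * s)^-1 * normc q.[z] ^+ 2 -
        normc p.[z] * normc q.[z] = (2 * s)^-1 * (s * normc p.[z] - normc q.[z]) ^+ 2.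
        by field; rewrite gt_eqF.
      by rewrite mulr_ge0 ?sqr_ge0// invr_ge0 mulr_ge0// ltW.
  rewrite disk_Rintegral_lin//.
  rewrite [leRHS](_ : s = s / 2 * 1 + (2 * s)^-1 * s ^+ 2); last first.
    by field; rewrite gt_eqF.
  by rewrite lerD// ler_wpM2l// ?invr_ge0 ?divr_ge0 ?mulr_ge0// ltW.
split; apply: bound => // z; rewrite -[X in X * _]normc_conjc -normcM.
- exact: normr_Re_le.
- exact: normr_Im_le.
Qed.

Hypothesis muD : mu (~` D) = 0%E.

Lemma Rintegral_disk f : continuous f ->
  \int[mu]_z f z = \int[mu]_(z in D) f z.
Proof.
move=> fc; have mD := @measurable_closed_unit_disk R.
have H (h : R[i] -> \bar R) : measurable_fun setT h -> (forall z, (0 <= h z)%E) ->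
    (\int[mu]_z h z = \int[mu]_(z in D) h z)%E.
  move=> mh h0; rewrite -(setUv D) ge0_integral_setU ?setUv//.
  - by rewrite [X in (_ + X)%E]null_set_integral ?adde0//; [exact: measurableC|exact: measurable_funTS].
  - exact: measurableC.
  - by apply/disj_setPCl.
have mf : measurable_fun setT (EFin \o f).
  by apply/measurable_EFinP; exact: continuous_measurable_funC.
rewrite /Rintegral; congr fine; rewrite [LHS]integralE [RHS]integralE !H//.
- exact: measurable_funeneg.
- exact: measurable_funepos.
Qed.

Variable P : nat -> {poly R[i]}.
Hypothesis PO : orthonormal_polys mu P.

Let k n : R := complex.Re (lead_coef (P n)).

Let k_gt0 n : 0 < k n.
Proof. by have [/(_ n)[_]] := PO; rewrite /k ltcE /= => /andP[]. Qed.

Let kC0 n : (k n)%:C != 0 :> R[i].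
Proof. by rewrite eq_complex /= eqxx andbT gt_eqF. Qed.

Let lead_k n : (P n)`_n = (k n)%:C.
Proof.
have [/(_ n)[sn]] := PO; rewrite /k /lead_coef sn /= ltcE /= => /andP[+ _].
by case: _`_n => x y /= /eqP ->.
Qed.

Let ipP n m : poly_ip (P n) (P m) = (n == m)%:R.
Proof.
have [_ /(_ n m) <-] := PO; rewrite /poly_ip /Cintegral.
by rewrite !Rintegral_disk; [|exact: continuous_hprodIm|exact: continuous_hprodRe].
Qed.

(** Subtracting a multiple of [P m] cancels the coefficient of index m and lowers the size bound by
    one, so [P n] is orthogonal to all degrees below n. *)
Let ip_low n m q : (size q <= m)%N -> (m <= n)%N -> poly_ip (P n) q = 0.
Proof.
elim: m q => [|m IH] q; first by rewrite leqn0 size_poly_eq0 => /eqP -> _; exact: poly_ip0r.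
move=> qm mn; set c := q`_m / (k m)%:C.
have -> : q = (q - c *: P m) + c *: P m by rewrite subrK.
rewrite poly_ipDr poly_ipZr ipP gtn_eqF// mulr0 addr0; apply: IH; last exact: ltnW.
apply/leq_sizeP => j; rewrite leq_eqVlt coefB coefZ => /predU1P[<-|mj].
  by rewrite lead_k /c divfK ?subrr// kC0.
rewrite !nth_default ?mulr0 ?subr0//; last exact: leq_trans qm _.
by have [/(_ m)[-> _]] := PO.
Qed.

(** The quotient of the leading coefficients of z^a p_n and p_(n+a), hence the factor of p_(n+a)
    that cancels the top term. *)
Let ratio n a : R := k n / k (n + a).

(* The component of [z^a p_n] orthogonal to [p_(n+a)]. *)
Let resid n a := 'X^a * P n - (ratio n a)%:C *: P (n + a).

Let size_resid n a : (size (resid n a) <= n + a)%N.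
Proof.
apply/leq_sizeP => j; rewrite leq_eqVlt coefB coefZ coefXnM => /predU1P[<-|mj].
  rewrite ltnNge leq_addl /= addnK !lead_k /ratio.
  by rewrite rmorphM /= fmorphV divfK ?subrr// kC0.
have [Ps _] := PO.
rewrite ltnNge (leq_trans (leq_addl n a) (ltnW mj)) /= !nth_default ?mulr0 ?subr0//.
- by rewrite (Ps (n + a)%N).1.
- by rewrite (Ps n).1 ltn_subRL addnC.
Qed.

Let XP n a : 'X^a * P n = (ratio n a)%:C *: P (n + a) + resid n a.
Proof. by rewrite addrC subrK. Qed.

Let ip_resid n a : poly_ip (P (n + a)) (resid n a) = 0.
Proof. exact: (ip_low (size_resid n a)). Qed.

Lemma poly_norm2_orthonormal n : poly_norm2 (P n) = 1.
Proof. by have := poly_ip_diag (P n); rewrite ipP eqxx => /(congr1 (@complex.Re R)). Qed.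

Let conjc_realC (x : R) : (x%:C^*)%C = x%:C.
Proof. by rewrite /= oppr0. Qed.

Let norm2_resid n a : poly_norm2 ('X^a * P n) = ratio n a ^+ 2 + poly_norm2 (resid n a).
Proof.
move: (XP n a) (ip_resid n a); move: (resid n a) => q -> Pq.
set p := _ + q.
have : poly_ip p p = (ratio n a ^+ 2 + poly_norm2 q)%:C.
  rewrite poly_ipDl !poly_ipDr !poly_ipZl !poly_ipZr ipP Pq eqxx.
  rewrite -(poly_ip_conj (P (n + a)) q) Pq poly_ip_diag.
  rewrite conjc_realC conjc0 !mulr0 add0r addr0 mulr1 -expr2.
  by rewrite rmorphD rmorphXn.
by rewrite poly_ip_diag => /(congr1 (@complex.Re R)).
Qed.

Let norm2_resid_le n a : ratio n a ^+ 2 + poly_norm2 (resid n a) <= 1.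
Proof. by rewrite -norm2_resid -(poly_norm2_orthonormal n); exact: poly_norm2XM. Qed.

Let ratio_gt0 n a : 0 < ratio n a.
Proof. by rewrite divr_gt0. Qed.

Let ratio_le1 n a : ratio n a <= 1.
Proof.
rewrite -(@ler_pXn2r _ 2)// ?nnegrE ?(ltW (ratio_gt0 _ _))// expr1n.
by apply: le_trans (norm2_resid_le n a); rewrite lerDl; exact: poly_norm2_ge0.
Qed.

Lemma lead_coef_orthonormal_nd n : k n <= k n.+1.
Proof.
by have := ratio_le1 n 1; rewrite /ratio addn1 ler_pdivrMr// mul1r.
Qed.

(** Expanding both arguments leaves ra rb delta_ab, rb <p_(n+b), resid a> and <resid b, z^a p_n>.
    The last two have real and imaginary parts at most s by Cauchy-Schwarz, and 1 - ra rb <= 1 - min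
    (ra, rb)^2 <= s^2. *)
Lemma poly_ip_shift n a b (s : R) : 0 < s ->
  1 - (k n / k (n + a)) ^+ 2 <= s ^+ 2 -> 1 - (k n / k (n + b)) ^+ 2 <= s ^+ 2 ->
  `|complex.Re (poly_ip ('X^b * P n) ('X^a * P n)) - (a == b)%:R| <= 2 * s + s ^+ 2 /\
  `|complex.Im (poly_ip ('X^b * P n) ('X^a * P n))| <= 2 * s.
Proof.
rewrite -/(ratio n a) -/(ratio n b) => s0 sa sb.
set ra := ratio n a; set rb := ratio n b.
have ra0 : 0 < ra by exact: ratio_gt0.
have rb0 : 0 < rb by exact: ratio_gt0.
have ra1 : ra <= 1 by exact: ratio_le1.
have rb1 : rb <= 1 by exact: ratio_le1.
have E : poly_ip ('X^b * P n) ('X^a * P n) = (ra * rb * (a == b)%:R)%:C +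
    (rb%:C * poly_ip (P (n + b)) (resid n a) + poly_ip (resid n b) ('X^a * P n)).
  rewrite {1}(XP n b) poly_ipDl poly_ipZl conjc_realC addrA; congr (_ + _).
  move: (XP n a); move: (resid n a) => q ->.
  rewrite poly_ipDr poly_ipZr ipP eqn_add2l -/ra -/rb mulrDr; congr (_ + _).
  rewrite (eq_sym b a); case: eqP => _; last by rewrite !mulr0.
  by rewrite !mulr1 mulrC -rmorphM.
have na : poly_norm2 (resid n a) <= s ^+ 2.
  by have := norm2_resid_le n a; lra.
have nb : poly_norm2 (resid n b) <= s ^+ 2.
  by have := norm2_resid_le n b; lra.
have n1 : poly_norm2 ('X^a * P n) <= 1 by rewrite norm2_resid; exact: norm2_resid_le.
have nP : poly_norm2 (P (n + b)) <= 1 by rewrite poly_norm2_orthonormal.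
have [A1 A2] := normr_poly_ip_le s0 nP na.
have [B1 B2] := normr_poly_ip_le s0 n1 nb.
move: A1 A2 B1 B2 E; rewrite -(poly_ip_conj ('X^a * P n) (resid n b)).
case: (poly_ip (P _) _) => x y; case: (poly_ip ('X^a * P n) (resid n b)) => x' y'.
move=> + + + + -> /= => A1 A2 B1 B2.
rewrite /= in A1 A2 B1 B2.
rewrite !mul0r subr0 addr0 add0r.
have xs : `|rb * x| <= s.
  by rewrite normrM gtr0_norm//; apply: le_trans A1; rewrite ler_piMl.
have ys : `|rb * y| <= s.
  by rewrite normrM gtr0_norm//; apply: le_trans A2; rewrite ler_piMl.
split; last first.
  apply: le_trans (ler_normD _ _) _; rewrite normrN; lra.
rewrite addrAC addrC; apply: le_trans (ler_normD _ _) _.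
apply: lerD; first by apply: le_trans (ler_normD _ _) _; lra.
case: eqP => [ab|_]; last by rewrite mulr0 subrr normr0 sqr_ge0.
rewrite mulr1 distrC ger0_norm; last by rewrite subr_ge0 mulr_ile1// ltW.
rewrite -/ra -/rb in sa sb; rewrite (_ : true%:R = 1)//; have [rab|/ltW rba] := leP ra rb.
- by have := ler_wpM2l (ltW ra0) rab; rewrite -expr2; lra.
- by have := ler_wpM2r (ltW rb0) rba; rewrite -expr2; lra.
Qed.

End orthonormal.

(** * Regularity and the limit along a set of density one *)

Section regular_measures.
Context {R : realType}.
Variable mu : {finite_measure set R[i] -> \bar R}.
Hypothesis mu_reg : regular_on_closed_disk mu.

Local Notation D := (@closed_unit_disk R).
Local Notation P := (orthonormal_poly mu).

Lemma regular_kappa_root (x : R) : x < 1 ->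
  \forall n \near \oo, x < kappa mu n `^ (- n%:R^-1).
Proof.
move=> x1; have [reg _ circ] := mu_reg.
have : nbhs (capacity (Defs.support mu)) [set y | (x%:E < y)%E].
  apply: open_nbhs_nbhs; split; first exact: open_ereal_gt_ereal.
  by apply: lt_le_trans (capacity_ge1 circ); rewrite lte_fin.
move=> /reg; apply: (@filterS _ (nbhs \oo)) => n.
by rewrite /= lte_fin.
Qed.

(* Without an orthonormal sequence, [orthonormal_poly mu] would be [fun=> 0] and
   the roots of [kappa mu n] would tend to 0 instead of to the capacity. *)
Lemma regular_orthonormal : orthonormal_polys mu P.
Proof.
have [ex|nex] := pselect (exists p, orthonormal_polys mu p).
  exact: xgetPex.
have P0 : P = fun=> 0.
  by apply: xgetPN => p pO; apply: nex; exists p.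
(* The index n0 + 1 is positive, so the exponent is nonzero; at exponent 0 the power of 0 would be
   1. *)
have [n0 _ /(_ n0.+1 (leqnSn _))] := regular_kappa_root (@ltr01 R).
by rewrite /kappa P0 lead_coef0 /= powR0 ?ltxx// oppr_eq0 invr_eq0 pnatr_eq0.
Qed.

Lemma regular_measure_setC_disk : mu (~` D) = 0%E.
Proof.
have [_ sD _] := mu_reg; apply: measure_negligible.
  by apply: measurableC; exact: measurable_closed_unit_disk.
apply: negligibleS (@negligible_setC_support R mu).
exact: subsetC.
Qed.

Let PO := regular_orthonormal.
Let muD := regular_measure_setC_disk.

Let kappa_gt0 n : 0 < kappa mu n.
Proof. by have [/(_ n)[_]] := PO; rewrite /kappa ltcE /= => /andP[]. Qed.

Lemma ln_kappa_slow (e : R) : 0 < e -> \forall n \near \oo, ln (kappa mu n) <= e * n%:R.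
Proof.
move=> e0; have e1 : expR (- e) < 1 by rewrite expR_lt1 oppr_lt0.
have [n0 _ n0P] := regular_kappa_root e1.
(* Starting at n0 + 1 excludes n = 0, where n^-1 is 0; for n > 0, taking logarithms of exp (- e) <
   kappa_n^(-1/n) gives the claim. *)
exists n0.+1 => // n /= n0n; have := n0P n (ltnW n0n).
have n_gt0 : (0 : R) < n%:R by rewrite ltr0n (leq_trans _ n0n).
rewrite /= /powR gt_eqF// ltr_expR mulNr ltrN2 mulrC ltr_pdivrMr//.
exact: ltW.
Qed.

(** conj (z^b p) z^a p = z^a conj (z)^b |p|^2, so the exponent b goes to the conjugated first
    argument. *)
Lemma Cintegral_sqnorm_measure n a b :
  Cintegral (sqnorm_measure mu (P n)) D (cmonom a b) =
  poly_ip mu ('X^b * P n) ('X^a * P n).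
Proof.
have [cR cI] := @continuous_cmonom R a b.
have E z : (('X^b * P n).[z])^*%C * ('X^a * P n).[z] =
    cmonom a b z * (normc (P n).[z] ^+ 2)%:C.
  rewrite !hornerM !hornerXn [X in X * _](_ : _ = (z^*)%C ^+ b * ((P n).[z])^*%C).
    rewrite mulrACA /cmonom [z ^+ a * _]mulrC; congr (_ * _).
    rewrite normc_sqr; case: (P n).[z] => x y; apply/eqP; rewrite eq_complex /=.
    by apply/andP; split; apply/eqP; ring.
  by rewrite [LHS]rmorphM; congr (_ * _); exact: rmorphXn.
rewrite /poly_ip /Cintegral !Rintegral_sqnorm_measure; [|exact: disk_continuous_within..].
congr (_ +i* _); apply: eq_Rintegral => z _; rewrite E; case: (cmonom a b z) => x y /=.
- by rewrite mulr0 subr0.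
- by rewrite mulr0 add0r.
Qed.

Lemma sqnorm_measure_disk n : sqnorm_measure mu (P n) D = 1%E.
Proof.
have mD := @measurable_closed_unit_disk R.
have := poly_norm2_orthonormal muD PO n; rewrite /poly_norm2 /Rintegral => H.
rewrite /sqnorm_measure -[RHS]/(1%:E) -H fineK//.
apply: integrable_fin_num => //; apply: disk_integrable.
  by rewrite -ge0_fin_numE// fin_num_measure.
exact: disk_continuous_normc_horner.
Qed.

End regular_measures.

Theorem theorem3p8 (R : realType) (mu : {finite_measure set R[i] -> \bar R})
    (mu_adm : admissible mu) (mu_reg : regular_on_closed_disk mu) :
  exists N : set nat,
    asymptotic_density1 (R := R) N /\
    weak_cvg closed_unit_disk (within N \oo)
      (fun n => sqnorm_measure mu (orthonormal_poly mu n)) arclength.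
Proof.
have PO := regular_orthonormal mu_reg.
have muD := regular_measure_setC_disk mu_reg.
have k0 n : 0 < kappa mu n.
  by have [/(_ n)[_]] := PO; rewrite /kappa ltcE /= => /andP[].
have Lnd n : ln (kappa mu n) <= ln (kappa mu n.+1).
  by rewrite ler_ln ?posrE//; exact: (lead_coef_orthonormal_nd muD PO n).
have [N [Nd NP]] := slow_growth_density1 Lnd (ln_kappa_slow mu_reg).
exists N; split => //.
apply: disk_weak_cvg.
- by move=> n; rewrite [leLHS](sqnorm_measure_disk mu_reg).
- by rewrite [leLHS](_ : _ = 1%E)//; exact: arclength_disk.
move=> a b; rewrite Cintegral_arclength_cmonom.
under eq_fun do rewrite Cintegral_sqnorm_measure//.
have near_s (s : R) : 0 < s -> \forall n \near within N \oo,
    1 - (kappa mu n / kappa mu (n + a)) ^+ 2 <= s ^+ 2 /\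
    1 - (kappa mu n / kappa mu (n + b)) ^+ 2 <= s ^+ 2.
  move=> s0; have s20 : 0 < s ^+ 2 / 2 by rewrite divr_gt0// exprn_gt0.
  (* With delta the increment of ln kappa, the quotient is exp (- delta), and 1 - exp (- 2 delta) <=
     2 delta <= s^2. *)
  have gap m n : ln (kappa mu (n + m)) - ln (kappa mu n) <= s ^+ 2 / 2 ->
      1 - (kappa mu n / kappa mu (n + m)) ^+ 2 <= s ^+ 2.
    move=> H; rewrite (_ : _ / _ = expR (ln (kappa mu n) - ln (kappa mu (n + m)))).
      rewrite -expRM_natl.
      by have := expR_ge1Dx (2%:R * (ln (kappa mu n) - ln (kappa mu (n + m)))); lra.
    by rewrite expRB !lnK ?posrE.
  near=> n; split; apply: gap; near: n.
  - exact: NP.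
  - exact: NP.
have bound (e : R) : 0 < e -> exists s : R, [/\ 0 < s, 2 * s <= e & 2 * s + s ^+ 2 <= e].
  (* From s <= 1 and s <= e / 3 follows 2 s + s^2 <= 3 s <= e. *)
  move=> e0; exists (Num.min 1 (e / 3)).
  have s0 : 0 < Num.min 1 (e / 3) by rewrite lt_min ltr01 divr_gt0.
  have s1 : Num.min 1 (e / 3) <= 1 by rewrite ge_min lexx.
  have se : Num.min 1 (e / 3) <= e / 3 by rewrite ge_min lexx orbT.
  by split=> //; nra.
rewrite (_ : (a == b)%:R = (a == b)%:R +i* 0 :> R[i]); last by case: (a == b).
rewrite (_ : (fun n => _) = fun n =>
  complex.Re (poly_ip mu ('X^b * orthonormal_poly mu n) ('X^a * orthonormal_poly mu n)) +i*
  complex.Im (poly_ip mu ('X^b * orthonormal_poly mu n) ('X^a * orthonormal_poly mu n))); last first.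
  by apply/funext => n; case: (poly_ip _ _ _).
apply: cvg_complex; apply/cvgrPdist_le => e e0; have [s [s0 s2 s3]] := bound e e0;
  apply: filterS (near_s s s0) => n [na nb];
  have [HR HI] := poly_ip_shift muD PO s0 na nb.
- by rewrite distrC; exact: le_trans HR s3.
- by rewrite sub0r normrN; exact: le_trans HI s2.
Unshelve. all: by end_near. Qed.
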